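(* Assume that $$\liminf_{n\to\infty}\left(\frac1{\gamma_{n+1}}-\frac1{\gamma_n}\right)>-\pi .$$ (a) Let $x\in(0,1)$. Then $$\mathbb{P}_x(X_\infty=0)>0\quad\Longleftrightarrow\quad \mathbb{P}\left(\sum_{n\ge1}\prod_{k=1}^n(1-\mathbf 1_{B_k}\gamma_k)<+\infty\right)>0,$$ and, $\mathbb{P}_x$-a.s. on the event $\{X_\infty=0\}$, there exists a (random) integer $n_0\ge1$ such that $$\forall\,n\ge n_0,\qquad X_n=X_{n_0}\prod_{k=n_0+1}^n(1-\mathbf 1_{B_k}\gamma_k).$$ In particular, $$\sum_{n\ge1}\prod_{k=1}^n(1-p_B\gamma_k)<+\infty\quad\Longrightarrow\quad\mathbb{P}_x(X_\infty=0)>0.$$ (b) If furthermore $\sum_{n\ge1}\gamma_n^2<+\infty$, then for $x\in(0,1)$ $$\mathbb{P}_x(X_\infty=0)>0\quad\Longleftrightarrow\quad\sum_{n\ge1}\prod_{k=1}^n(1-p_B\gamma_k)<+\infty,$$ and moreover there is a random variable $\Xi_x>0$ such that $$X_n\sim\Xi_x\prod_{k=1}^n(1-p_B\gamma_k)\quad\text{as } n\to\infty,\quad\mathbb{P}_x\text{-a.s. on }\{X_\infty=0\}.$$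
   Context: Let $0<p_B<p_A<1$ and $\pi=p_A-p_B>0$. Let $(\gamma_n)_{n\ge1}$ be a deterministic sequence in $(0,1)$ with $\Gamma_n=\sum_{k=1}^n\gamma_k\to+\infty$. Let $(U_n)_{n\ge1}$ be i.i.d. uniform random variables on $[0,1]$, and let $(A_n)_{n\ge1}$, $(B_n)_{n\ge1}$ be events with $\mathbb{P}(A_n)=p_A$, $\mathbb{P}(B_n)=p_B$ for all $n$; the pairs $(\mathbf 1_{A_n},\mathbf 1_{B_n})_{n\ge1}$ are independent in $n$ (no assumption is made on the dependence between $A_n$ and $B_n$), and the sequence $(\mathbf 1_{A_n},\mathbf 1_{B_n})_{n\ge1}$ is independent of $(U_n)_{n\ge1}$. The two-armed bandit algorithm is defined by $X_0=x$ and $$X_{n+1}=X_n+\gamma_{n+1}\left(\mathbf 1_{\{U_{n+1}\le X_n\}\cap A_{n+1}}(1-X_n)-\mathbf 1_{\{U_{n+1}>X_n\}\cap B_{n+1}}X_n\right),\quad n\ge0.$$ The notation $\mathbb{P}_x$ refers to $X_0=x$. The sequence $(X_n)$ takes values in $[0,1]$ and converges a.s. to a random variable $X_\infty$ with values in $\{0,1\}$ a.s. For positive sequences, $a_n\sim b_n$ means $a_n=b_n+o(b_n)$; empty products equal $1$. *)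

(* Defs.v *)
From HB Require Import structures.
From mathcomp Require Export all_boot all_order all_algebra finmap.
From mathcomp Require Export all_classical all_reals all_analysis.

Set Implicit Arguments.
Unset Strict Implicit.
Unset Printing Implicit Defensive.

Export Order.TTheory GRing.Theory Num.Theory numFieldNormedType.Exports.

#[export] Set Implicit Arguments.
#[export] Unset Strict Implicit.
#[export] Unset Printing Implicit Defensive.

Local Open Scope classical_set_scope.
Local Open Scope ring_scope.

(* Mutual independence of a sequence of random elements: the product rule over
   every finite subfamily. *)
Definition mutually_independent d d' (T : measurableType d)
    (T' : measurableType d') (R : realType) (P : probability T R)
    (f : nat -> T -> T') : Prop :=
  forall (J : {fset nat}) (E : nat -> set T'), (forall n, measurable (E n)) ->
    P (\bigcap_(n in [set` J]) (f n @^-1` E n)) =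
    (\prod_(n <- J) P (f n @^-1` E n))%E.

(* The sigma-algebra generated by all the terms of a sequence. *)
Definition seq_sigma_algebra d' (T : Type) (T' : measurableType d')
    (f : nat -> T -> T') : set_system T :=
  <<s \bigcup_n preimage_set_system setT (f n) measurable >>.

Definition independent_seqs d d1 d2 (T : measurableType d)
    (T1 : measurableType d1) (T2 : measurableType d2) (R : realType)
    (P : probability T R) (f : nat -> T -> T1) (g : nat -> T -> T2) : Prop :=
  forall E F : set T, seq_sigma_algebra f E -> seq_sigma_algebra g F ->
    P (E `&` F) = (P E * P F)%E.

Definition indic_pair (T : Type) (R : realType) (A B : nat -> set T) (n : nat)
    (w : T) : R * R := (\1_(A n) w, \1_(B n) w).

(* gamma, U, A and B are used only at indices n >= 1; their terms of index 0
   are never read. *)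
Fixpoint bandit (T : Type) (R : realType) (gamma : nat -> R) (U : nat -> T -> R)
    (A B : nat -> set T) (x : R) (n : nat) : T -> R :=
  if n is m.+1 then
    let X := bandit gamma U A B x m in
    fun w => X w + gamma m.+1 *
      (\1_([set v | U m.+1 v <= X v] `&` A m.+1) w * (1 - X w)
       - \1_([set v | U m.+1 v > X v] `&` B m.+1) w * X w)
  else cst x.

(* Main.v *)
From HB Require Import structures.
Require Import Defs.
From mathcomp Require Import measurable_realfun ring lra.

Local Open Scope classical_set_scope.
Local Open Scope ring_scope.

(** Write pi = pA - pB, X_n for the state after n steps and S_n for the sum of
X_k over k < n.  Only finitely many events are observed up to time n: at each
step, whether the threshold variable falls below the state (call it a jump) and
whether A and B occur.  The state is a function of that finite history, so the
independence hypotheses serve to give every history a product probability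
([P_cylinder_split], [bandit_trans_law]).  From there on a supermartingale is a
nonnegative function W of histories whose weighted sum over the possible next
moves is at most W: no conditional expectation occurs.  The single probabilistic
tool is the maximal inequality for such functions ([maximal_inequality]) and its
corollary [ae_bounded]: if the supermartingale inequality holds along a path
from some time on, then almost surely W stays bounded along that path.

On the event that X_n tends to 0, three choices of W show that only finitely
many jumps occur.

- The hypothesis on gamma says that X_n / gamma_n has a drift at least
  proportional to X_n as long as X_n is small.  Hence
  W = exp (- c X_n / gamma_n + b S_n) is a supermartingale for small constants
  c and b, and its boundedness forces X_n / gamma_n to tend to infinity if S_n
  does ([exp_drift]).
- As soon as gamma_(n+1) <= (pi / 2) X_n, the function W = 1 / X_n is a
  supermartingale, and its boundedness prevents X_n from tending to 0
  ([inv_state_drift]).  The two together give that S_n is bounded on the event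
  ([ae_summable]).
- A jump has probability X_n, so the number of jumps increased by the unspent
  part of a budget K for S_n is a supermartingale; bounded S_n therefore means
  finitely many jumps ([ae_finitely_many_jumps]).

After the last jump X_n is multiplied by 1 - 1_(B_n) gamma_n at each step.  This
is the product formula, and since S_n is bounded the products are summable.

Conversely, the path that never jumps is x times the product of the factors
1 - 1_(B_k) gamma_k, and it is driven by the events A and B only.  By
independence from the thresholds, no jump occurs in n steps with probability at
least exp (- K / (1 - x)) given those events, if this path has sum at most K
([P_no_jump_ge]).  So if the products are summable with positive probability,
then with positive probability they are summable and no jump ever occurs, and
then X_n tends to 0 ([prob_zero_gt0]).  When the products of the mean factors
1 - pB gamma_k are summable, the sum of the random products is almost surely
finite by one more supermartingale ([loss_drift]).

If gamma_n is square summable, the logarithm of the ratio between the random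
product and the mean product is, up to an absolutely convergent series, a sum of
independent centred variables with summable variances.  It converges almost
surely by Kolmogorov's maximal inequality, which is the same maximal inequality
applied to the squared sum ([walk_drift], [ae_cvg_walk]).  Hence the ratio has a
positive limit ([ae_product_equiv]), which transfers summability and gives the
equivalent of X_n. *)

(** * Series and sequences of real numbers *)

Definition bounded_sums (R : realType) (u : nat -> R) :=
  exists K, forall n, \sum_(1 <= k < n.+1) u k <= K.

Lemma bounded_sums_dom (R : realType) (u v : nat -> R) (C : R) N :
  (forall n, (1 <= n)%N -> 0 <= v n) -> 0 <= C ->
  (forall n, (N <= n)%N -> (1 <= n)%N -> u n <= C * v n) ->
  bounded_sums v -> bounded_sums u.
Proof.
move=> v0 C0 uv [K vK]; exists (\sum_(1 <= k < N.+1) `|u k| + C * K) => n.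
apply: (@le_trans _ _ (\sum_(1 <= k < n.+1)
    ((if (k <= N)%N then `|u k| else 0) + C * v k))).
  rewrite big_nat_cond [leRHS]big_nat_cond; apply: ler_sum => k /andP[/andP[k1 _] _].
  case: leqP => kN; first by rewrite (le_trans (ler_norm _)) // lerDl mulr_ge0 // v0.
  by rewrite add0r uv // ltnW.
rewrite big_split /= lerD //; last by rewrite -mulr_sumr ler_wpM2l.
rewrite -big_mkcond /=.
have [nN|Nn] := leqP n N.
  rewrite [leRHS](big_cat_nat (n := n.+1)) //=.
  apply: (@le_trans _ _ (\sum_(1 <= i < n.+1) `|u i|)).
    by rewrite [leRHS](bigID (fun i => (i <= N)%N)) /= lerDl sumr_ge0.
  by rewrite lerDl sumr_ge0.
rewrite (big_cat_nat (n := N.+1)) //=; last by rewrite ltnS ltnW.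
rewrite [X in _ + X]big_nat_cond [X in _ + X]big1 ?addr0 => [|k]; last first.
  by move=> /andP[/andP[Nk _]]; rewrite leqNgt Nk.
by rewrite [leRHS](bigID (fun i => (i <= N)%N)) /= lerDl sumr_ge0.
Qed.

(** Otherwise infinitely many disjoint blocks would each contribute more than
[e]. *)
Lemma bounded_sums_tail (R : realType) (u : nat -> R) (e : R) :
  (forall n, (1 <= n)%N -> 0 <= u n) -> bounded_sums u -> 0 < e ->
  exists N, forall n, (N <= n)%N -> \sum_(N.+1 <= k < n.+1) u k <= e.
Proof.
move=> u0 [K uK] e0; apply: contrapT => nN.
have step N : exists2 n, (N <= n)%N & e < \sum_(N.+1 <= k < n.+1) u k.
  apply: contrapT => H; apply: nN; exists N => n Nn; rewrite leNgt.
  by apply/negP => ?; apply: H; exists n.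
have grow (j : nat) : exists n, j%:R * e <= \sum_(1 <= k < n.+1) u k.
  elim: j => [|j [n jn]]; first by exists 0%N; rewrite big_geq // mul0r.
  have [m nm em] := step n; exists m.
  rewrite (big_cat_nat (n := n.+1)) //= -natr1 mulrDl mul1r.
  by rewrite lerD // ltW.
have [n] := grow (Num.truncn (K / e)).+1; rewrite leNgt => /negP; apply.
apply: le_lt_trans (uK n) _; rewrite -ltr_pdivrMr //; exact: truncnS_gt.
Qed.

Lemma limn_einf_gt (R : realType) (a : R) (u : nat -> R) :
  (a%:E < limn_einf (fun n => (u n)%:E))%E ->
  exists e N, 0 < e /\ forall n, (N <= n)%N -> a + e <= u n.
Proof.
have /cvg_lim einfs_lim := @cvg_einfs_sup _ (fun n => (u n)%:E).
rewrite limn_einf_lim einfs_lim // => /ereal_sup_gt[_ [N _ <-]].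
set l := einfs _ N => al.
have ul n : (N <= n)%N -> (l <= (u n)%:E)%E.
  by move=> Nn; apply: ereal_inf_lbound; exists n.
case: l al ul => [l||] //; last by move=> _ /(_ N (leqnn N)); rewrite leye_eq.
rewrite lte_fin => al ul; exists (l - a), N; split; first by rewrite subr_gt0.
by move=> n /ul; rewrite lee_fin addrCA subrr addr0.
Qed.

Lemma nneseries_lt_pinftyP (R : realType) (u : nat -> R) :
  (forall n, (1 <= n)%N -> 0 <= u n) ->
  ((\sum_(1 <= n <oo) (u n)%:E < +oo)%E <-> bounded_sums u).
Proof.
move=> u0; split=> [|[K uK]].
  set s := limn _ => s_fin.
  have s0 : (0 <= s)%E by apply: nneseries_ge0 => n n1 _; rewrite lee_fin u0.
  exists (fine s) => n; rewrite -lee_fin fineK ?ge0_fin_numE // -sumEFin.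
  by apply: nneseries_lim_ge => k k1 _; rewrite lee_fin u0.
apply: (@le_lt_trans _ _ K%:E); last exact: ltry.
apply: lime_le.
  by apply: is_cvg_nneseries => n n1 _; rewrite lee_fin u0.
apply: nearW => -[|n].
  rewrite big_geq // lee_fin; apply: le_trans (uK 0%N); by rewrite big_geq.
by rewrite sumEFin lee_fin.
Qed.

Lemma cvg0_le (R : realType) (u : nat -> R) (e : R) : u @ \oo --> 0 -> 0 < e ->
  exists N, forall n, (N <= n)%N -> u n <= e.
Proof.
move=> /cvgrPdist_le /(_ e) + e0 => /(_ e0)[N _ uN].
by exists N => n /uN /=; rewrite sub0r normrN; apply: le_trans; rewrite ler_norm.
Qed.

Lemma bounded_sums_cvg0 (R : realType) (u : nat -> R) :
  (forall n, (1 <= n)%N -> 0 <= u n) -> bounded_sums u -> u @ \oo --> 0.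
Proof.
move=> u0 bu; apply/cvgrPdist_le => e e0.
have [N uN] := bounded_sums_tail u0 bu e0.
exists N.+1 => // n /= Nn; have n1 : (1 <= n)%N by rewrite (leq_trans _ Nn).
rewrite sub0r normrN ger0_norm ?u0 //; apply: le_trans (uN n (ltnW Nn)).
rewrite big_nat_recr //= lerDr big_nat_cond sumr_ge0 // => k /andP[/andP[Nk _] _].
by rewrite u0 // (leq_trans _ Nk).
Qed.

Lemma cauchy_seq_cvg (R : realType) (u : nat -> R) :
  (forall j : nat, exists N, forall n, (N <= n)%N -> `|u n - u N| < j.+1%:R^-1) ->
  cvgn u.
Proof.
move=> cu; apply/cauchy_cvgP/cauchy_exP => e e0.
have eN : (Num.truncn e^-1).+1%:R^-1 <= e.
  rewrite -[leRHS]invrK lef_pV2 ?posrE ?invr_gt0 ?ltr0n //.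
  exact/ltW/truncnS_gt.
have [N uN] := cu (Num.truncn e^-1); exists (u N), N => // n /= Nn.
by rewrite /ball /= distrC; exact: lt_le_trans (uN n Nn) eN.
Qed.

Lemma bounded_sums_is_cvg (R : realType) (u : nat -> R) :
  (forall n, (1 <= n)%N -> 0 <= u n) -> bounded_sums u ->
  cvgn (fun n => \sum_(1 <= k < n.+1) u k).
Proof.
move=> u0 [K uK]; apply: nondecreasing_is_cvgn.
  by apply/nondecreasing_seqP => n; rewrite [leRHS]big_nat_recr //= lerDl u0.
by exists K => _ [n _ <-]; exact: uK.
Qed.

Lemma cvg_ratio_equiv (R : realType) (f g : nat -> R) (l : R) :
  0 < l -> (forall n, 0 < g n) -> (fun n => f n / g n) @ \oo --> l ->
  f ~_\oo (fun n => l * g n).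
Proof.
move=> l0 g0 fg; apply/eqaddoP => e e0.
move/cvgrPdist_le : fg => /(_ (e * l)); rewrite mulr_gt0 // => /(_ isT).
apply: filterS => n fgn.
rewrite [X in `|X|](_ : _ = (f n / g n - l) * g n); last first.
  by rewrite mulrBl divfK // gt_eqF.
rewrite !normrM (gtr0_norm l0) mulrA ler_wpM2r //.
by rewrite distrC.
Qed.

(** [m] is the relative deviation of a random factor from its mean factor.  The
logarithm of the ratio is [m] up to an error of second order in [g]; the sign of
the error makes the series of errors monotone, so that bounding it is enough. *)
Lemma log_loss_bound (R : realType) (p g : R) (b : bool) :
  0 <= p <= 1 -> 0 < g < 1 ->
  let m := g / (1 - p * g) * (p - b%:R) in
  [/\ 1 + m = (1 - b%:R * g) / (1 - p * g), 0 < 1 + m &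
      0 <= m - ln (1 + m) <= (g / (1 - g)) ^+ 2].
Proof.
move=> /andP[p0 p1] /andP[g0 g1] m.
have pg : 1 - g <= 1 - p * g by rewrite lerD2l lerN2 ler_piMl // ltW.
have bg : 1 - g <= 1 - b%:R * g.
  by rewrite lerD2l lerN2 ler_piMl ?(ltW g0) // lern1 leq_b1.
have g'0 : 0 < 1 - g by rewrite subr_gt0.
have pg0 := lt_le_trans g'0 pg; have bg0 := lt_le_trans g'0 bg.
have mE : 1 + m = (1 - b%:R * g) / (1 - p * g).
  by rewrite /m; field; rewrite gt_eqF.
have m0 : 0 < 1 + m by rewrite mE divr_gt0.
split=> //; apply/andP; split; first by rewrite subr_ge0 le_ln1Dx //; lra.
(* ln (1 + m) >= m / (1 + m), from ln y <= y - 1 at y = 1 / (1 + m). *)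
have le_ln : ln (1 + m)^-1 <= (1 + m)^-1 - 1.
  rewrite -[in leLHS](subrK 1 (1 + m)^-1) [_ - 1 + 1]addrC le_ln1Dx //.
  by rewrite ltrBrDl subrr invr_gt0.
rewrite lnV // in le_ln.
apply: (@le_trans _ _ (m + ((1 + m)^-1 - 1))); first by rewrite lerD2l.
have -> : m + ((1 + m)^-1 - 1) =
    (g * (p - b%:R)) ^+ 2 / ((1 - p * g) * (1 - b%:R * g)).
  by rewrite mE /m; field; rewrite !gt_eqF.
rewrite expr_div_n ler_pM ?invr_ge0 ?sqr_ge0 ?mulr_ge0 ?(ltW pg0) ?(ltW bg0) //.
  by rewrite exprMn ler_piMr ?sqr_ge0 //; case: (b) => /=; nra.
by rewrite lef_pV2 ?posrE ?mulr_gt0 ?exprn_gt0 // expr2 ler_pM // ltW.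
Qed.

(** * Null sets and monotone families of events *)

Lemma measure_bigcup_le (d : measure_display) (T : measurableType d)
    (R : realType) (P : probability T R) (F : nat -> set T) (c : \bar R) :
  (forall n, measurable (F n)) -> nondecreasing_seq F ->
  (forall n, P (F n) <= c)%E -> (P (\bigcup_n F n) <= c)%E.
Proof.
move=> mF ndF Fc; apply: (@cvge_le _ \oo _ _ (P \o F)); last first.
  by apply: nondecreasing_cvg_mu => //; exact: bigcupT_measurable.
exact: nearW.
Qed.

Lemma measure_bigcap_ge (d : measure_display) (T : measurableType d)
    (R : realType) (P : probability T R) (F : nat -> set T) (c : \bar R) :
  (forall n, measurable (F n)) -> nonincreasing_seq F ->
  (forall n, c <= P (F n))%E -> (c <= P (\bigcap_n F n))%E.
Proof.
move=> mF niF Fc; apply: (@cvge_ge _ \oo _ _ (P \o F)); last first.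
  apply: nonincreasing_cvg_mu => //; last exact: bigcapT_measurable.
  exact: le_lt_trans (probability_le1 _ (mF _)) (ltry _).
exact: nearW.
Qed.

Section Negligible.
Variables (d : measure_display) (T : measurableType d) (R : realType).
Variable P : probability T R.

Lemma negligible_small (S : set T) :
  (forall e : R, 0 < e -> exists E, [/\ measurable E, S `<=` E & (P E <= e%:E)%E]) ->
  P.-negligible S.
Proof.
move=> small.
have {}small (n : nat) : exists E,
    [/\ measurable E, S `<=` E & (P E <= (n.+1%:R^-1)%:E)%E].
  by apply: small; rewrite invr_gt0.
pose E n := sval (cid (small n)).
have EP n : [/\ measurable (E n), S `<=` E n & (P (E n) <= (n.+1%:R^-1)%:E)%E].
  exact: (svalP (cid (small n))).
have mE : measurable (\bigcap_n E n) by apply: bigcapT_measurable => n; case: (EP n).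
exists (\bigcap_n E n); split=> //; last by move=> w Sw n _; case: (EP n) => _ /(_ _ Sw).
apply/eqP; rewrite -measure_le0; apply/lee_addgt0Pr => e e0; rewrite add0e.
pose n := Num.truncn e^-1; have [mEn _ PEn] := EP n.
apply: (@le_trans _ _ (P (E n))).
  by apply: le_measure; rewrite ?inE // => w /(_ n I).
apply: le_trans PEn _; rewrite lee_fin -[leRHS]invrK lef_pV2 ?posrE ?invr_gt0 //.
exact/ltW/truncnS_gt.
Qed.

Lemma ae_le_measure (E F : set T) : measurable E -> measurable F ->
  {ae P, forall w, E w -> F w} -> (P E <= P F)%E.
Proof.
move=> mE mF [N [mN PN sub]]; rewrite -(measureU0 mF mN PN).
apply: le_measure; rewrite ?inE //; first exact: measurableU.
move=> w Ew; have [Fw|nF] := pselect (F w); [by left|right].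
by apply: sub => /(_ Ew).
Qed.

Lemma P_disintegrate (S : finType) (f : T -> S) (D : set T) :
  (forall s, measurable (D `&` [set w | f w = s])) ->
  P D = (\sum_s P (D `&` [set w | f w = s]))%E.
Proof.
move=> mf.
have triv : trivIset [set: S] (fun s => D `&` [set w | f w = s]).
  by move=> s t _ _ [w /= [[_ <-] [_ <-]]].
have DE : D = \bigcup_(s in [set` index_enum S]) (D `&` [set w | f w = s]).
  apply/seteqP; split=> w; last by case=> s _ [].
  by move=> Dw; exists (f w) => //=; exact: mem_index_enum.
rewrite {1}DE measure_fin_bigcup //; last exact: sub_trivIset triv.
by rewrite -fsbig_seq // index_enum_uniq.
Qed.

(** This carries what is known of almost every path to a conclusion in which no
path occurs. *)
Lemma ae_exists (E : set T) (Q : T -> Prop) : measurable E -> (0 < P E)%E ->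
  {ae P, forall w, Q w} -> exists2 w, E w & Q w.
Proof.
move=> mE PE aeQ; apply: contrapT => nE.
have : P.-negligible E.
  by apply: negligibleS aeQ => w Ew Qw; apply: nE; exists w.
by move/(measure_negligible mE) => PE0; rewrite PE0 ltxx in PE.
Qed.
End Negligible.

(** * Processes with finite histories *)

Section DiscreteHistory.
Variables (d : measure_display) (T : measurableType d) (R : realType).
Variables (P : probability T R) (M : finType).
Variables (step : seq M -> T -> M) (trans : seq M -> M -> R).

(** The most recent move comes first, so that functions of the past are defined
by structural recursion. *)
Fixpoint hist n (w : T) : seq M :=
  if n is k.+1 then step (hist k w) w :: hist k w else [::].

Definition cylinder (h : seq M) : set T := [set w | hist (size h) w = h].

Hypothesis step_measurable : forall h m, measurable [set w | step h w = m].
Hypothesis trans_law : forall h m,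
  P (cylinder (m :: h)) = (P (cylinder h) * (trans h m)%:E)%E.

Lemma size_hist n w : size (hist n w) = n.
Proof. by elim: n => //= n ->. Qed.

Lemma cylinder_cons m h :
  cylinder (m :: h) = cylinder h `&` [set w | step h w = m].
Proof.
apply/seteqP; split=> w; rewrite /cylinder /=.
  by move=> [sm hh]; rewrite hh in sm.
by case=> -> ->.
Qed.

Lemma measurable_cylinder h : measurable (cylinder h).
Proof.
elim: h => [|m h IH]; last by rewrite cylinder_cons; exact: measurableI.
rewrite (_ : cylinder [::] = setT) //; exact/seteqP.
Qed.

Lemma measurable_hist n (Q : set (seq M)) : measurable [set w | Q (hist n w)].
Proof.
pose F i : set T := if choice.unpickle i is Some h then
  (if `[< Q h /\ size h = n >] then cylinder h else set0) else set0.
rewrite (_ : [set w | _] = \bigcup_i F i).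
  apply: bigcupT_measurable => i; rewrite /F.
  by case: choice.unpickle => // h; case: asbool => //; exact: measurable_cylinder.
apply/seteqP; split=> w /=.
  move=> Qw; exists (choice.pickle (hist n w)) => //; rewrite /F choice.pickleK.
  by rewrite asboolT ?size_hist // /cylinder /= size_hist.
case=> i _; rewrite /F; case: choice.unpickle => // h.
by case: asboolP => // -[Qh sh]; rewrite /cylinder /= sh => ->.
Qed.

Section Maximal.
Variables (alive : set (seq M)) (W : seq M -> R).
Hypothesis W_ge0 : forall h, 0 <= W h.
Hypothesis W_super : forall h, alive h -> \sum_m trans h m * W (m :: h) <= W h.

(** The recursion peels off the first step, as in the induction that bounds the
probability of this event; [k] is the number of steps left. *)
Fixpoint hits lam k n : set T :=
  [set w | lam <= W (hist n w)] `|`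
  (if k is j.+1 then [set w | alive (hist n w)] `&` hits lam j n.+1 else set0).

Lemma measurable_hits lam k n : measurable (hits lam k n).
Proof.
elim: k n => [|k IH] n /=.
  by apply: measurableU => //; exact: (@measurable_hist n (fun h => lam <= W h)).
apply: measurableU; first exact: (@measurable_hist n (fun h => lam <= W h)).
by apply: measurableI => //; exact: (@measurable_hist n alive).
Qed.

Lemma le_hits lam k n : hits lam k n `<=` hits lam k.+1 n.
Proof.
elim: k n => [|k IH] n w /=; first by case=> // ?; left.
case; first by left.
by case=> ? H; right; split=> //; exact: (IH n.+1 w H).
Qed.

Lemma hitsP lam j n w : (forall i, (n <= i < n + j)%N -> alive (hist i w)) ->
  lam <= W (hist (n + j) w) -> hits lam j n w.
Proof.
elim: j n => [|j IH] n al; first by rewrite addn0; left.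
rewrite addnS -addSn => ge; right; split.
  by apply: al; rewrite leqnn addnS ltnS leq_addr.
by apply: IH => // i /andP[ni inj]; apply: al; rewrite ltnW //= addnS -addSn.
Qed.

(** First-step analysis: [W h / lam] bounds the probability of reaching [lam]
trivially when [W h] is already above [lam] or when the chain is no longer
alive, and otherwise because it does not increase in mean at the first step. *)
Lemma P_cylinder_hits lam k h : 0 < lam ->
  (P (cylinder h `&` hits lam k (size h)) <= P (cylinder h) * (W h / lam)%:E)%E.
Proof.
move=> lam0; elim: k h => [|k IH] h.
  have [ge|lt] := leP lam (W h).
    apply: (@le_trans _ _ (P (cylinder h))).
      apply: le_measure; rewrite ?inE; [|exact: measurable_cylinder|by move=> ? []].
      by apply: measurableI; [exact: measurable_cylinder|exact: measurable_hits].
    by rewrite lee_pemulr // lee_fin ler_pdivlMr // mul1r.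
  rewrite (_ : _ `&` _ = set0) ?measure0; last first.
    apply/seteqP; split=> // w []; rewrite /cylinder /= => -> [] //=.
    by rewrite leNgt lt.
  by rewrite mule_ge0 // lee_fin divr_ge0 // ltW.
have [ge|lt] := leP lam (W h).
  apply: (@le_trans _ _ (P (cylinder h))).
    apply: le_measure; rewrite ?inE; [|exact: measurable_cylinder|by move=> ? []].
    by apply: measurableI; [exact: measurable_cylinder|exact: measurable_hits].
  by rewrite lee_pemulr // lee_fin ler_pdivlMr // mul1r.
have [al|nal] := pselect (alive h); last first.
  rewrite (_ : _ `&` _ = set0) ?measure0; last first.
    apply/seteqP; split=> // w []; rewrite /cylinder /= => -> [] //=.
      by rewrite leNgt lt.
    by case.
  by rewrite mule_ge0 // lee_fin divr_ge0 // ltW.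
set D := (X in P X).
have DE m : D `&` [set w | step h w = m] =
    cylinder (m :: h) `&` hits lam k (size (m :: h)).
  rewrite cylinder_cons /D; apply/seteqP; split=> w [] [] /=.
    move=> ch; have := ch; rewrite /cylinder /= => -> [|[_ ?]] //.
    by rewrite leNgt lt.
  by move=> ch sm ?; split=> //; split=> //; right; split=> //; rewrite ch.
rewrite (@P_disintegrate _ _ _ P _ (step h)); last first.
  move=> m; rewrite DE; apply: measurableI; first exact: measurable_cylinder.
  exact: measurable_hits.
have [p p0 pE] : exists2 p : R, 0 <= p & P (cylinder h) = p%:E.
  exists (fine (P (cylinder h))); first exact: fine_ge0.
  by rewrite fineK // fin_num_measure //; exact: measurable_cylinder.
apply: (@le_trans _ _ (\sum_m (p * (trans h m * W (m :: h)) / lam)%:E)%E).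
  apply: lee_sum => m _; rewrite DE; apply: le_trans (IH _) _.
  by rewrite [X in (X * _)%E]trans_law pE -!EFinM lee_fin !mulrA.
rewrite sumEFin pE -EFinM lee_fin -mulr_suml -mulr_sumr -mulrA.
rewrite ler_wpM2l // ler_wpM2r ?invr_ge0 ?(ltW lam0) //; exact: W_super.
Qed.

Lemma maximal_inequality lam h : 0 < lam ->
  (P (cylinder h `&` \bigcup_k hits lam k (size h)) <=
   P (cylinder h) * (W h / lam)%:E)%E.
Proof.
move=> lam0; rewrite setI_bigcupr; apply: measure_bigcup_le => [k||k].
- by apply: measurableI; [exact: measurable_cylinder|exact: measurable_hits].
- by apply/nondecreasing_seqP => k; apply/subsetPset; apply: setIS; exact: le_hits.
- exact: P_cylinder_hits.
Qed.

(** This replaces the convergence theorem for nonnegative supermartingales: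
started from the time at which the path becomes alive for ever, [W] exceeds a
level [lam] with a probability of order [1 / lam].  There are countably many
histories at which this can start. *)
Lemma ae_bounded : {ae P, forall w,
  (exists N, forall n, (N <= n)%N -> alive (hist n w)) ->
  exists C N, forall n, (N <= n)%N -> W (hist n w) <= C}.
Proof.
pose Z h : set T := [set w | [/\ cylinder h w,
  forall n, (size h <= n)%N -> alive (hist n w) &
  forall C, exists2 n, (size h <= n)%N & C <= W (hist n w)]].
have Z_null h : P.-negligible (Z h).
  apply: negligible_small => e e0; pose lam := W h / e + 1.
  have lam0 : 0 < lam by rewrite ltr_wpDl // divr_ge0 // ltW.
  exists (cylinder h `&` \bigcup_k hits lam k (size h)); split.
  - apply: measurableI; first exact: measurable_cylinder.
    by apply: bigcupT_measurable => k; exact: measurable_hits.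
  - move=> w [hw al unb]; split=> //; have [n hn Wn] := unb lam.
    exists (n - size h)%N => //; apply: hitsP; last by rewrite subnKC.
    by move=> i /andP[hi _]; exact: al.
  - apply: le_trans (maximal_inequality _ lam0) _.
    apply: (@le_trans _ _ (1 * (W h / lam)%:E)%E).
      apply: lee_wpmul2r; first by rewrite lee_fin divr_ge0 // ltW.
      exact/probability_le1/measurable_cylinder.
    rewrite mul1e lee_fin ler_pdivrMr // mulrDr mulr1 mulrC divfK ?gt_eqF //.
    by rewrite lerDl ltW.
pose F i := if choice.unpickle i is Some h then Z h else set0.
apply: (@negligibleS _ _ _ _ (\bigcup_i F i)); last first.
  apply: negligible_bigcup => i; rewrite /F.
  by case: choice.unpickle => // *; exact: negligible_set0.
move=> w /= /not_implyP[[N al] nb].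
exists (choice.pickle (hist N w)) => //; rewrite /F choice.pickleK.
split; rewrite ?size_hist //; first by rewrite /cylinder /= size_hist.
move=> C; apply: contrapT => nC; apply: nb; exists C, N => n Nn.
by apply/ltW; rewrite ltNge; apply/negP => ge; apply: nC; exists n.
Qed.
End Maximal.
End DiscreteHistory.

(** * The law of the history of the bandit *)

Fixpoint fset_below n : {fset nat} :=
  if n is k.+1 then (k |` fset_below k)%fset else fset0.

Lemma in_fset_below n k : (k \in fset_below n) = (k < n)%N.
Proof.
by elim: n => // n IH; rewrite /= in_fset1U IH ltnS [RHS]leq_eqVlt.
Qed.

Lemma set_fset_below n : [set` fset_below n] = `I_n.
Proof. by apply/seteqP; split=> k /=; rewrite in_fset_below. Qed.

Lemma mutually_independent_bigcapS d d' (T : measurableType d)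
    (T' : measurableType d') (R : realType) (P : probability T R)
    (f : nat -> T -> T') (E : nat -> set T') n :
  mutually_independent P f -> (forall k, measurable (E k)) ->
  P (\bigcap_(k in `I_n.+1) (f k @^-1` E k)) =
  (P (\bigcap_(k in `I_n) (f k @^-1` E k)) * P (f n @^-1` E n))%E.
Proof.
move=> ind mE; rewrite -!set_fset_below !ind //= big_fsetU1 /=; last first.
  by rewrite in_fset_below ltnn.
exact: muleC.
Qed.

Lemma sigma_algebra_bigcap (T : pointedType) (G : set (set T)) n (F : nat -> set T) :
  (forall k, (k < n)%N -> G (F k)) -> <<s G >> (\bigcap_(k in `I_n) F k).
Proof.
move=> GF; rewrite bigcap_mkord.
elim: n GF => [|n IH] GF.
  rewrite big_ord0; exact: (@measurableT _ (g_sigma_algebraType G)).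
rewrite big_ord_recr /=.
apply: (@measurableI _ (g_sigma_algebraType G)).
  by apply: IH => k kn; apply: GF; exact: ltnW.
by apply: sub_sigma_algebra; exact: GF.
Qed.

Lemma uniform_prob_le (R : realType) (v : R) : 0 <= v <= 1 ->
  uniform_prob (@ltr01 R) `]-oo, v] = v%:E.
Proof.
move=> /andP[v0 v1]; rewrite /uniform_prob integral_uniform_pdf.
rewrite (_ : _ `&` _ = `[0, v]%classic); last first.
  apply/seteqP; split=> r /=; rewrite !in_itv /=.
    by move=> [-> /andP[-> _]].
  by move=> /andP[-> rv]; rewrite rv; split=> //; exact: le_trans rv v1.
rewrite (eq_integral (fun=> 1%:E)); last first.
  move=> r; rewrite inE /= in_itv /= /uniform_pdf => /andP[-> rv].
  by rewrite (le_trans rv v1) subr0 invr1.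
rewrite integral_cst //= mul1e lebesgue_measure_itv /= lte_fin sube0.
by case: ltgtP v0 => // <-.
Qed.

(** The first bit says whether the threshold variable is at most the state (a
jump), the other two whether A and B occur. *)
Notation move := (bool * bool * bool)%type.

Fixpoint state (R : realType) (gamma : nat -> R) (x : R) (h : seq move) : R :=
  if h is (u, a, b) :: h' then
    let X := state gamma x h' in
    X + gamma (size h').+1 * ((u && a)%:R * (1 - X) - (~~ u && b)%:R * X)
  else x.

(** The joint law [q] of the two bits may vary with time; only its marginals are
prescribed. *)
Definition move_trans (R : realType) (gamma : nat -> R) (x : R)
    (q : nat -> bool -> bool -> R) (h : seq move) (m : move) : R :=
  q (size h).+1 m.1.2 m.2 *
  (if m.1.1 then state gamma x h else 1 - state gamma x h).

Section BanditHistory.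
Variables (R : realType) (d : measure_display) (T : measurableType d).
Variables (P : probability T R) (gamma : nat -> R) (x : R).
Variables (U : nat -> {RV P >-> R}) (A B : nat -> set T).

Hypothesis hgamma : forall n, (1 <= n)%N -> 0 < gamma n < 1.
Hypothesis hx : 0 < x < 1.
Hypothesis hU : forall n, (1 <= n)%N -> forall E : set R, measurable E ->
  distribution P (U n) E = uniform_prob (@ltr01 R) E.
Hypothesis hUind : mutually_independent P (fun n => U n.+1 : T -> R).
Hypothesis hAm : forall n, (1 <= n)%N -> measurable (A n).
Hypothesis hBm : forall n, (1 <= n)%N -> measurable (B n).
Hypothesis hABind : mutually_independent P (fun n => indic_pair R A B n.+1).
Hypothesis hABU : independent_seqs P (fun n => indic_pair R A B n.+1)
  (fun n => U n.+1 : T -> R).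

Definition bandit_step (h : seq move) (w : T) : move :=
  (U (size h).+1 w <= state gamma x h, w \in A (size h).+1, w \in B (size h).+1).

Definition pair_law n a b : R :=
  fine (P [set w | (w \in A n) = a /\ (w \in B n) = b]).

Local Notation bandit_trans := (move_trans gamma x pair_law).

Lemma state01 h : 0 < state gamma x h < 1.
Proof.
elim: h => // -[[u a] b] h /= /andP[X0 X1].
have /andP[g0 g1] : 0 < gamma (size h).+1 < 1 by exact: hgamma.
case: u; rewrite /= ?mul0r ?subr0 ?sub0r.
  by case: a; rewrite ?mul1r ?mul0r ?mulr0 ?addr0 ?X0 ?X1 //; apply/andP; split; nra.
by case: b; rewrite ?mul1r ?mul0r ?oppr0 ?mulr0 ?addr0 ?X0 ?X1 //; apply/andP; split; nra.
Qed.

Lemma bandit_hist n w : bandit gamma U A B x n w = state gamma x (hist bandit_step n w).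
Proof.
elim: n w => //= n IH w.
rewrite /bandit_step IH size_hist; congr (_ + _ * (_ * _ - _ * _)); rewrite indicE.
  congr ((nat_of_bool _)%:R).
  apply/idP/andP; rewrite !inE /=.
    by case; rewrite !IH; split=> //; rewrite mem_set.
  by rewrite IH; case=> ? ?; split=> //; exact/set_mem.
congr ((nat_of_bool _)%:R); rewrite -ltNge.
apply/idP/andP; rewrite !inE /=.
  by case; rewrite IH; split=> //; rewrite mem_set.
by rewrite IH; case=> ? ?; split=> //; exact/set_mem.
Qed.

Lemma indic_pair_preimage n (a b : bool) :
  indic_pair R A B n @^-1` [set (a%:R, b%:R)] =
  [set w | (w \in A n) = a /\ (w \in B n) = b].
Proof.
have natr_bool_inj (c e : bool) : c%:R = e%:R :> R -> c = e.
  by move=> /eqP; rewrite eqr_nat => /eqP; case: c; case: e.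
apply/seteqP; split=> w; rewrite /indic_pair /= !indicE.
  by case=> /natr_bool_inj -> /natr_bool_inj ->.
by case=> -> ->.
Qed.

Lemma measurable_pair_event n a b : (1 <= n)%N ->
  measurable [set w | (w \in A n) = a /\ (w \in B n) = b].
Proof.
move=> n1; pose S (D : set T) (c : bool) := if c then D else ~` D.
rewrite (_ : [set w | _] = S (A n) a `&` S (B n) b).
  by apply: measurableI; [case: a | case: b] => /=; do ?apply: measurableC;
    [exact: hAm|exact: hAm|exact: hBm|exact: hBm].
have SE D c w : S D c w <-> (w \in D) = c.
  case: c; rewrite /S /=; split; try by move=> /mem_set.
  - by move=> /set_mem.
  - by move=> nD; apply/negbTE; rewrite notin_setE.
  - by move/negbT; rewrite notin_setE.
by apply/seteqP; split=> w [/SE ? /SE ?].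
Qed.

Lemma pair_law_ge0 n a b : 0 <= pair_law n a b.
Proof. exact: fine_ge0. Qed.

Lemma pair_lawE n a b : (1 <= n)%N ->
  P [set w | (w \in A n) = a /\ (w \in B n) = b] = (pair_law n a b)%:E.
Proof.
by move=> n1; rewrite /pair_law fineK // fin_num_measure //; exact: measurable_pair_event.
Qed.

Lemma pair_law_marginl n a : (1 <= n)%N ->
  ((pair_law n a true + pair_law n a false)%:E = P [set w | (w \in A n) = a])%E.
Proof.
move=> n1; rewrite EFinD -!pair_lawE // -measureU; last 3 first.
- exact: measurable_pair_event.
- exact: measurable_pair_event.
- by apply/seteqP; split=> // w [[_ /= ->]] [].
congr (P _); apply/seteqP; split=> w /=; first by case=> -[].
by case: (w \in B n); [left|right].
Qed.

Lemma pair_law_marginr n b : (1 <= n)%N ->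
  ((pair_law n true b + pair_law n false b)%:E = P [set w | (w \in B n) = b])%E.
Proof.
move=> n1; rewrite EFinD -!pair_lawE // -measureU; last 3 first.
- exact: measurable_pair_event.
- exact: measurable_pair_event.
- by apply/seteqP; split=> // w [[/= -> _]] [].
congr (P _); apply/seteqP; split=> w /=; first by case=> -[].
by case: (w \in A n); [left|right].
Qed.

Fixpoint pair_pattern (h : seq move) (k : nat) : set (R * R) :=
  if h is m :: h' then
    if k == size h' then [set (m.1.2%:R, m.2%:R)] else pair_pattern h' k
  else setT.

Definition threshold_set (u : bool) (v : R) : set R :=
  if u then `]-oo, v]%classic else `]v, +oo[%classic.

(** A fixed history determines all its earlier states, so what it requires of the
threshold of a given step is membership in a fixed half-line. *)
Fixpoint threshold_pattern (h : seq move) (k : nat) : set R :=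
  if h is m :: h' then
    if k == size h' then threshold_set m.1.1 (state gamma x h')
    else threshold_pattern h' k
  else setT.

Definition pair_event h :=
  \bigcap_(k in `I_(size h)) (indic_pair R A B k.+1 @^-1` pair_pattern h k).
Definition threshold_event h :=
  \bigcap_(k in `I_(size h)) ((U k.+1 : T -> R) @^-1` threshold_pattern h k).

Lemma measurable_pair_pattern h k : measurable (pair_pattern h k).
Proof.
elim: h => //= m h IH; case: ifP => // _.
rewrite (_ : [set _] = [set m.1.2%:R] `*` [set m.2%:R]); first exact: measurableX.
by apply/seteqP; split=> -[y z] /= [-> ->].
Qed.

Lemma measurable_threshold_set u v : measurable (threshold_set u v).
Proof. by case: u; exact: measurable_itv. Qed.

Lemma measurable_threshold_pattern h k : measurable (threshold_pattern h k).
Proof.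
by elim: h => //= m h IH; case: ifP => // _; exact: measurable_threshold_set.
Qed.

Lemma bigcap_patternS (I : Type) (f : nat -> T -> I) (E E' : nat -> set I) n :
  (forall k, (k < n)%N -> E k = E' k) ->
  \bigcap_(k in `I_n.+1) (f k @^-1` E k) =
  f n @^-1` E n `&` \bigcap_(k in `I_n) (f k @^-1` E' k).
Proof.
move=> EE'; rewrite IISl bigcap_setU1; congr (_ `&` _).
by apply: eq_bigcapr => k /= kn; rewrite EE'.
Qed.

Lemma pair_pattern_below m h k : (k < size h)%N ->
  pair_pattern (m :: h) k = pair_pattern h k.
Proof. by move=> kh; rewrite /= ltn_eqF. Qed.

Lemma threshold_pattern_below m h k : (k < size h)%N ->
  threshold_pattern (m :: h) k = threshold_pattern h k.
Proof. by move=> kh; rewrite /= ltn_eqF. Qed.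

(** Since the states are determined by [h], the event of following [h] is a
rectangle for the bits and the thresholds: this is where the dependence between
steps disappears and the product rules apply. *)
Lemma cylinder_rectangle h :
  cylinder bandit_step h = pair_event h `&` threshold_event h.
Proof.
elim: h => [|m h IH].
  rewrite /pair_event /threshold_event /= II0 !bigcap_set0 setIT.
  by apply/seteqP; split.
rewrite cylinder_cons IH /pair_event /threshold_event.
rewrite (bigcap_patternS _ (@pair_pattern_below m h)).
rewrite (bigcap_patternS _ (@threshold_pattern_below m h)).
set V1 := \bigcap_(k in _) _; set V2 := \bigcap_(k in _) _.
rewrite /= eqxx indic_pair_preimage.
case: m => -[u a] b /=; rewrite /bandit_step.
apply/seteqP; split=> w /=.
  move=> [[v1 v2] [<- <- <-]]; split=> //; split=> //.
  by rewrite /threshold_set; case: leP => c; rewrite /= in_itv /= ?c ?andbT.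
move=> [[[<- <-] v1] [us v2]]; split=> //; congr (_, _, _).
by move: us; rewrite /threshold_set; case: u; rewrite /= in_itv /= ?andbT // leNgt => ->.
Qed.

Lemma P_threshold n u v : (1 <= n)%N -> 0 <= v <= 1 ->
  P ((U n : T -> R) @^-1` threshold_set u v) = (if u then v else 1 - v)%:E.
Proof.
move=> n1 v01.
have PU : P ((U n : T -> R) @^-1` `]-oo, v]) = v%:E.
  rewrite -(uniform_prob_le v01) -(hU n1) //.
case: u => //=.
rewrite (_ : _ @^-1` _ = ~` ((U n : T -> R) @^-1` `]-oo, v])).
  rewrite probability_setC ?PU // -[X in measurable X]setTI.
  exact: measurable_funPT.
by apply/seteqP; split=> w /=; rewrite !in_itv /= andbT ltNge => /negP.
Qed.

Lemma P_cylinder_split h :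
  P (cylinder bandit_step h) = (P (pair_event h) * P (threshold_event h))%E.
Proof.
rewrite cylinder_rectangle; apply: hABU.
- apply: sigma_algebra_bigcap => k _; exists k => //.
  by exists (pair_pattern h k); [exact: measurable_pair_pattern|rewrite setTI].
- apply: sigma_algebra_bigcap => k _; exists k => //.
  by exists (threshold_pattern h k);
    [exact: measurable_threshold_pattern|rewrite setTI].
Qed.

Lemma P_pair_event_cons m h : P (pair_event (m :: h)) =
  (P (pair_event h) * (pair_law (size h).+1 m.1.2 m.2)%:E)%E.
Proof.
rewrite /pair_event /= (mutually_independent_bigcapS _ hABind) /=; last first.
  exact: measurable_pair_pattern (m :: h).
rewrite eqxx indic_pair_preimage pair_lawE //; congr (P _ * _)%E.
by apply: eq_bigcapr => k /= kh; rewrite ltn_eqF.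
Qed.

Lemma P_threshold_event_cons m h : P (threshold_event (m :: h)) =
  (P (threshold_event h) *
   (if m.1.1 then state gamma x h else 1 - state gamma x h)%:E)%E.
Proof.
rewrite /threshold_event /= (mutually_independent_bigcapS _ hUind) /=; last first.
  exact: measurable_threshold_pattern (m :: h).
have /andP[X0 X1] := state01 h.
rewrite eqxx P_threshold ?(ltW X0) ?(ltW X1) //; congr (P _ * _)%E.
by apply: eq_bigcapr => k /= kh; rewrite ltn_eqF.
Qed.

Lemma bandit_trans_law h m : P (cylinder bandit_step (m :: h)) =
  (P (cylinder bandit_step h) * (bandit_trans h m)%:E)%E.
Proof.
rewrite !P_cylinder_split P_pair_event_cons P_threshold_event_cons.
by rewrite muleACA -EFinM.
Qed.

Lemma measurable_bandit_step h m : measurable [set w | bandit_step h w = m].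
Proof.
case: m => -[u a] b.
rewrite (_ : [set w | _] =
    [set w | (w \in A (size h).+1) = a /\ (w \in B (size h).+1) = b] `&`
    (U (size h).+1 : T -> R) @^-1` threshold_set u (state gamma x h)).
  apply: measurableI; first exact: measurable_pair_event.
  rewrite -[X in measurable X]setTI.
  apply: measurable_funPT => //; exact: measurable_threshold_set.
apply/seteqP; split=> w; rewrite /bandit_step /=.
  move=> [<- <- <-]; split=> //.
  by rewrite /threshold_set; case: leP => c; rewrite /= in_itv /= ?c ?andbT.
move=> [[<- <-] us]; congr (_, _, _).
by move: us; rewrite /threshold_set; case: u; rewrite /= in_itv /= ?andbT // leNgt => ->.
Qed.
End BanditHistory.

(** * Drift inequalities *)

Lemma expR_le_quadratic (R : realType) (t : R) : t <= 2^-1 ->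
  expR t <= 1 + t + 2 * t ^+ 2.
Proof.
move=> t2; have t1 : 0 < 1 - t by lra.
rewrite -[t in expR t]opprK expRN.
apply: (@le_trans _ _ (1 - t)^-1).
  by rewrite lef_pV2 ?posrE ?expR_gt0 // expR_ge1Dx.
rewrite -[leLHS]mul1r ler_pdivrMr //; nra.
Qed.

Section Drift.
Variables (R : realType) (gamma : nat -> R) (x pA pB : R).
Variable q : nat -> bool -> bool -> R.

Local Notation X := (state gamma x).
Local Notation trans := (move_trans gamma x q).

Hypothesis hgamma : forall n, (1 <= n)%N -> 0 < gamma n < 1.
Hypothesis hx : 0 < x < 1.
Hypothesis hpA : 0 <= pA <= 1.
Hypothesis hpB : 0 <= pB <= 1.
Hypothesis q_ge0 : forall n a b, 0 <= q n a b.
Hypothesis q_marginl : forall n a, (1 <= n)%N ->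
  q n a true + q n a false = if a then pA else 1 - pA.
Hypothesis q_marginr : forall n b, (1 <= n)%N ->
  q n true b + q n false b = if b then pB else 1 - pB.

Lemma sum_move (F : move -> R) :
  \sum_m F m = \sum_u \sum_a \sum_b F (u, a, b).
Proof.
rewrite pair_bigA; rewrite (pair_bigA _ (fun (p : bool * bool) b => F (p.1, p.2, b))) /=.
by apply: eq_bigr => -[[]].
Qed.

(** A jump can be followed only by the effect of A and the absence of a jump only
by the effect of B, so that the dependence between the two bits is invisible. *)
Lemma sum_trans h (f g : bool -> R) :
  \sum_m trans h m * (if m.1.1 then f m.1.2 else g m.2) =
  X h * (pA * f true + (1 - pA) * f false) +
  (1 - X h) * (pB * g true + (1 - pB) * g false).
Proof.
rewrite sum_move !big_bool /= /move_trans /=.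
have lt := @q_marginl (size h).+1 true isT.
have lf := @q_marginl (size h).+1 false isT.
have rt := @q_marginr (size h).+1 true isT.
have rf := @q_marginr (size h).+1 false isT.
rewrite -[1 - pA]lf -[1 - pB]rf /= in lt rt *.
rewrite -[pA]lt -[in RHS]rt; ring.
Qed.

Lemma sum_trans_le h (F : move -> R) (f g : bool -> R) :
  (forall u a b, F (u, a, b) <= if u then f a else g b) ->
  \sum_m trans h m * F m <=
  X h * (pA * f true + (1 - pA) * f false) +
  (1 - X h) * (pB * g true + (1 - pB) * g false).
Proof.
move=> Ffg; rewrite -sum_trans; apply: ler_sum => -[[u a] b] _.
apply: ler_wpM2l; last exact: Ffg.
have /andP[X0 X1] := state01 hgamma hx h.
by rewrite /move_trans mulr_ge0 //=; case: ifP => _; [exact: ltW|rewrite subr_ge0 ltW].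
Qed.

(** The inverse of the state gains from the losses at rate [pB] and is reduced by
the gains at rate [pA]; the convexity correction to the second effect is of
relative order [gamma / X], which the hypothesis makes smaller than the
difference of the rates. *)
Lemma inv_state_drift h : pB < pA -> gamma (size h).+1 <= (pA - pB) / 2 * X h ->
  \sum_m trans h m * (X (m :: h))^-1 <= (X h)^-1.
Proof.
move=> pBA small.
have /andP[X0 X1] := state01 hgamma hx h.
have /andP[g0 g1] : 0 < gamma (size h).+1 < 1 by exact: hgamma.
set g := gamma _ in small g0 g1 *.
pose f (a : bool) := (X h + g * (a%:R * (1 - X h)))^-1.
pose f' (b : bool) := (X h - g * (b%:R * X h))^-1.
apply: le_trans (@sum_trans_le h (fun m => (X (m :: h))^-1) f f' _) _.
  move=> [] a b /=; rewrite /f /f' -/g ?andbT ?andTb ?mul0r ?subr0 //.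
  by rewrite sub0r mulrN.
rewrite /f /f' /= !mul0r !mulr0 addr0 subr0 !mul1r.
have Y0 : 0 < X h + g * (1 - X h) by nra.
have Z0 : 0 < 1 - g by lra.
rewrite (_ : X h - g * X h = X h * (1 - g)); last by ring.
rewrite invfM -subr_ge0.
rewrite (_ : _ - _ = g * (1 - X h) / (X h * (X h + g * (1 - X h)) * (1 - g)) *
   (pA * X h * (1 - g) - pB * (X h + g * (1 - X h)))); last first.
  by field; rewrite !gt_eqF.
rewrite mulr_ge0 //.
  by rewrite divr_ge0 ?mulr_ge0 ?(ltW Z0) ?(ltW Y0) ?(ltW g0) ?(ltW X0) // subr_ge0 ltW.
case/andP: hpA => pA0 pA1; case/andP: hpB => pB0 pB1.
have: (pA * X h + pB) * g <= (pA * X h + pB) * ((pA - pB) / 2 * X h).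
  by apply: ler_wpM2l => //; nra.
have: (pA * X h + pB) * ((pA - pB) / 2 * X h) <= 2 * ((pA - pB) / 2 * X h).
  by apply: ler_wpM2r; nra.
have : 0 <= g * (pB * X h) by rewrite !mulr_ge0 // ltW.
lra.
Qed.

Fixpoint prefix_sum (h : seq move) : R :=
  if h is _ :: h' then prefix_sum h' + X h' else 0.

Definition exp_lyapunov (eps : R) (h : seq move) : R :=
  expR (- (eps / 48 * (X h / gamma (size h))) +
        eps / 48 * eps / 4 * prefix_sum h).

(** The increment of [X / gamma] is [X] times the increment of [1 / gamma] plus
the gain or minus the loss, so that it dominates a variable with mean
[(eps - (pA - pB) X) X] and a second moment of order [X].  For a small multiple
[c] of [eps] the first-order term of the exponential dominates the second-order
one and still leaves room for the term [c * eps / 4 * X] due to the prefix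
sum. *)
Lemma exp_drift (eps : R) h : pB < pA -> 0 < eps <= pA - pB ->
  (0 < size h)%N ->
  - (pA - pB) + eps <= (gamma (size h).+1)^-1 - (gamma (size h))^-1 ->
  X h <= eps / 4 ->
  \sum_m trans h m * exp_lyapunov eps (m :: h) <= exp_lyapunov eps h.
Proof.
move=> pBA /andP[e0 e1] h0 de Xe; set W := exp_lyapunov eps.
pose c := eps / 48.
have /andP[X0 X1] := state01 hgamma hx h.
have /andP[g0 g1] : 0 < gamma (size h).+1 < 1 by exact: hgamma.
have /andP[g'0 g'1] : 0 < gamma (size h) < 1 by exact: hgamma.
case/andP: hpA => pA0 pA1; case/andP: hpB => pB0 pB1.
(* [K * X h] bounds the part of the exponent that does not depend on the move;
   [tf] and [tg] are the resulting exponents after a jump and without one. *)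
pose K := c * (pA - pB - eps) + c * eps / 4.
pose k := K * X h.
have c0 : 0 < c by rewrite /c; lra.
have cE : 48 * c = eps by rewrite /c; lra.
have K0 : 0 <= K by rewrite /K; nra.
have Kc : K <= c by rewrite /K; nra.
have k0 : 0 <= k by rewrite /k mulr_ge0 // ltW.
have kc : k <= c by rewrite /k; nra.
pose tf (a : bool) := k - c * (a%:R * (1 - X h)).
pose tg (b : bool) := k + c * (b%:R * X h).
pose f a := W h * (1 + tf a + 2 * tf a ^+ 2).
pose g b := W h * (1 + tg b + 2 * tg b ^+ 2).
have W0 : 0 < W h by exact: expR_gt0.
apply: le_trans (@sum_trans_le h (fun m => W (m :: h)) f g _) _.
  move=> u a b.
  have step t : t <= 2^-1 ->
      c * (X (((u, a), b) :: h) / gamma (size h).+1) >=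
      c * (X h / gamma (size h)) + c * eps / 4 * X h - t ->
      W (((u, a), b) :: h) <= W h * (1 + t + 2 * t ^+ 2).
    move=> t2 le; apply: (@le_trans _ _ (W h * expR t)); last first.
      by rewrite ler_pM2l //; exact: expR_le_quadratic.
    by rewrite /W /exp_lyapunov -/c -expRD ler_expR; move: le => /=; lra.
  have drift : c * (X h / gamma (size h).+1) >=
      c * (X h / gamma (size h)) + c * eps / 4 * X h - k.
    rewrite /k /K.
    have : (- (pA - pB) + eps) * (c * X h) <=
        ((gamma (size h).+1)^-1 - (gamma (size h))^-1) * (c * X h).
      by apply: ler_wpM2r => //; nra.
    lra.
  have Xg v : (X h + gamma (size h).+1 * v) / gamma (size h).+1 =
      X h / gamma (size h).+1 + v.
    by field; rewrite gt_eqF.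
  case: u step => step.
    apply: step; first by rewrite /tf; case: (a) => /=; nra.
    by rewrite [X (_ :: _)]/= Xg mul0r subr0 /tf; move: drift; lra.
  apply: step; first by rewrite /tg; case: (b) => /=; nra.
  by rewrite [X (_ :: _)]/= Xg mul0r sub0r /tg; move: drift; lra.
rewrite /f /g !(mulrCA _ (W h)) -!mulrDr !(mulrCA _ (W h)) -mulrDr.
rewrite -[leRHS]mulr1 ler_pM2l // /tf /tg {f g tf tg} /= !mul0r !mul1r !mulr0 subr0 addr0.
set Y := X h in X0 X1 Xe k k0 kc *.
have kY : k <= c * Y by rewrite /k ler_wpM2r // ltW.
have cY : c * Y <= c by nra.
have sq1 : (k - c * (1 - Y)) ^+ 2 <= c ^+ 2.
  by rewrite -subr_ge0 subr_sqr mulr_ge0 //; nra.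
have sq0 : k ^+ 2 <= c ^+ 2 * Y.
  apply: (@le_trans _ _ ((c * Y) ^+ 2)); first by rewrite ler_sqr ?nnegrE //; nra.
  by rewrite exprMn ler_wpM2l ?sqr_ge0 //; nra.
have sq2 : (k + c * Y) ^+ 2 <= 4 * (c ^+ 2 * Y).
  apply: (@le_trans _ _ ((2 * (c * Y)) ^+ 2)); first by rewrite ler_sqr ?nnegrE //; nra.
  by rewrite !exprMn -natrX ler_wpM2l // ler_wpM2l ?sqr_ge0 //; nra.
have c2Y : 0 <= c ^+ 2 * Y by rewrite mulr_ge0 ?sqr_ge0 // ltW.
have E1 : pA * (k - c * (1 - Y)) ^+ 2 + (1 - pA) * k ^+ 2 <= c ^+ 2.
  have : pA * (k - c * (1 - Y)) ^+ 2 <= pA * c ^+ 2 by rewrite ler_wpM2l.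
  have : (1 - pA) * k ^+ 2 <= (1 - pA) * c ^+ 2.
    by rewrite ler_wpM2l ?subr_ge0 // ler_sqr ?nnegrE // ltW.
  lra.
have E2 : pB * (k + c * Y) ^+ 2 + (1 - pB) * k ^+ 2 <= 4 * (c ^+ 2 * Y).
  have : pB * (k + c * Y) ^+ 2 <= pB * (4 * (c ^+ 2 * Y)) by rewrite ler_wpM2l.
  have : (1 - pB) * k ^+ 2 <= (1 - pB) * (4 * (c ^+ 2 * Y)).
    by rewrite ler_wpM2l ?subr_ge0 //; lra.
  lra.
have E1' : Y * (pA * (k - c * (1 - Y)) ^+ 2 + (1 - pA) * k ^+ 2) <= c ^+ 2 * Y.
  by rewrite mulrC ler_wpM2r // ltW.
have E2' : (1 - Y) * (pB * (k + c * Y) ^+ 2 + (1 - pB) * k ^+ 2) <=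
    4 * (c ^+ 2 * Y).
  apply: le_trans E2; rewrite ler_piMl //; last by lra.
  by rewrite addr_ge0 // mulr_ge0 ?sqr_ge0 // subr_ge0.
have lin : k <= c * (pA - pB) * Y * (1 - Y) - 10 * (c ^+ 2 * Y).
  have : (pA - pB) * Y <= Y by apply: ler_piMl; lra.
  move=> piY.
  have : 0 <= c * Y * (3 * eps / 4 - (pA - pB) * Y - 10 * c).
    by rewrite !mulr_ge0 ?(ltW c0) ?(ltW X0) //; lra.
  by rewrite /k /K; lra.
lra.
Qed.

Fixpoint count_jump (h : seq move) : R :=
  if h is m :: h' then count_jump h' + (m.1.1)%:R else 0.

(** The unspent part of the budget [K] compensates for the expected number of
jumps to come; the maximum keeps the function nonnegative at every history. *)
Definition count_lyapunov K h := count_jump h + Num.max 0 (K - prefix_sum h).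

Lemma count_drift K h : prefix_sum h + X h <= K ->
  \sum_m trans h m * count_lyapunov K (m :: h) <= count_lyapunov K h.
Proof.
move=> hK; rewrite /count_lyapunov.
have /andP[X0 X1] := state01 hgamma hx h.
have -> : Num.max 0 (K - prefix_sum h) = K - prefix_sum h.
  by apply/max_idPr; lra.
pose v := count_jump h + (K - prefix_sum h - X h).
apply: le_trans (@sum_trans_le h _ (fun=> v + 1) (fun=> v) _) _.
  move=> u a b /=.
  have -> : Num.max 0 (K - (prefix_sum h + X h)) = K - prefix_sum h - X h.
    by rewrite opprD addrA; apply/max_idPr; lra.
  by case: u; rewrite /v /=; lra.
by rewrite /v; nra.
Qed.

Lemma sum_trans_B h (g : bool -> R) :
  \sum_m trans h m * g m.2 = pB * g true + (1 - pB) * g false.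
Proof.
rewrite sum_move !big_bool /= /move_trans /=.
have rt := @q_marginr (size h).+1 true isT.
have rf := @q_marginr (size h).+1 false isT.
rewrite -[1 - pB]rf /= in rt *; rewrite -rt; ring.
Qed.

Fixpoint loss_prod (h : seq move) : R :=
  if h is m :: h' then loss_prod h' * (1 - (m.2)%:R * gamma (size h').+1)
  else 1.

Fixpoint loss_prod_sum (h : seq move) : R :=
  if h is _ :: h' then loss_prod_sum h' + loss_prod h else 0.

Definition mean_prod n : R := \prod_(1 <= k < n.+1) (1 - pB * gamma k).

Definition loss_lyapunov (sigma : R) (h : seq move) : R :=
  loss_prod_sum h + loss_prod h *
  ((sigma - \sum_(1 <= k < (size h).+1) mean_prod k) / mean_prod (size h)).

Lemma mean_prodS n : mean_prod n.+1 = mean_prod n * (1 - pB * gamma n.+1).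
Proof. by rewrite /mean_prod big_nat_recr. Qed.

Lemma mean_prod_gt0 n : 0 < mean_prod n.
Proof.
rewrite /mean_prod big_nat_cond; apply: prodr_gt0 => k /andP[/andP[k1 _] _].
have /andP[g0 g1] := hgamma k1; case/andP: hpB => pB0 pB1; nra.
Qed.

(** [loss_lyapunov] is the expected value of the whole sum of products given the
history, if [sigma] is the sum of the mean products: it is a martingale. *)
Lemma loss_drift sigma h :
  \sum_m trans h m * loss_lyapunov sigma (m :: h) = loss_lyapunov sigma h.
Proof.
pose s := \sum_(1 <= k < (size h).+1) mean_prod k.
pose G (b : bool) := loss_prod_sum h + loss_prod h * (1 - b%:R * gamma (size h).+1) *
  ((sigma - s) / mean_prod (size h).+1).
rewrite (eq_bigr (fun m => trans h m * G m.2)); last first.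
  move=> m _; rewrite /loss_lyapunov /= big_nat_recr //= -/s; congr (_ * _).
  rewrite /G; have := mean_prod_gt0 (size h).+1.
  set p := mean_prod _ => p0.
  by rewrite (_ : sigma - (s + p) = sigma - s - p); [field; rewrite gt_eqF|ring].
rewrite sum_trans_B /G /loss_lyapunov -/s mean_prodS /=.
have p0 := mean_prod_gt0 (size h).
have := mean_prod_gt0 (size h).+1; rewrite mean_prodS pmulr_rgt0 // => g0.
by field; rewrite !gt_eqF.
Qed.

Variable c : nat -> R.

Fixpoint loss_walk (h : seq move) : R :=
  if h is m :: h' then loss_walk h' + c (size h').+1 * (pB - (m.2)%:R) else 0.

Definition walk_lyapunov (sigma : R) (h : seq move) : R :=
  loss_walk h ^+ 2 + (sigma - \sum_(1 <= k < (size h).+1) c k ^+ 2).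

(** The square of a centred walk increases in mean by the variance of the step,
which the decrease of the tail of the series of [c k ^+ 2] covers. *)
Lemma walk_drift sigma h :
  \sum_m trans h m * walk_lyapunov sigma (m :: h) <= walk_lyapunov sigma h.
Proof.
pose s := \sum_(1 <= k < (size h).+1) c k ^+ 2.
pose C := c (size h).+1.
pose G (b : bool) := (loss_walk h + C * (pB - b%:R)) ^+ 2 + (sigma - (s + C ^+ 2)).
rewrite (eq_bigr (fun m => trans h m * G m.2)); last first.
  by move=> m _; rewrite /walk_lyapunov /= big_nat_recr.
rewrite sum_trans_B /G /walk_lyapunov -/s /=.
have : 0 <= C ^+ 2 * (1 - pB * (1 - pB)).
  by rewrite mulr_ge0 ?sqr_ge0 //; case/andP: hpB => pB0 pB1; nra.
nra.
Qed.
End Drift.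

(** * Paths that tend to zero *)

Definition path_loss_prod (R : realType) (T : Type) (gamma : nat -> R)
    (B : nat -> set T) (n : nat) (w : T) : R :=
  \prod_(1 <= k < n.+1) (1 - \1_(B k) w * gamma k).

Section Bandit.
Variables (R : realType) (d : measure_display) (T : measurableType d).
Variables (P : probability T R) (pA pB : R) (gamma : nat -> R) (x : R).
Variables (U : nat -> {RV P >-> R}) (A B : nat -> set T).

Hypothesis hpB : 0 < pB.
Hypothesis hpBA : pB < pA.
Hypothesis hpA : pA < 1.
Hypothesis hgamma : forall n, (1 <= n)%N -> 0 < gamma n < 1.
Hypothesis hx : 0 < x < 1.
Hypothesis hU : forall n, (1 <= n)%N -> forall E : set R, measurable E ->
  distribution P (U n) E = uniform_prob (@ltr01 R) E.
Hypothesis hUind : mutually_independent P (fun n => U n.+1 : T -> R).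
Hypothesis hAm : forall n, (1 <= n)%N -> measurable (A n).
Hypothesis hBm : forall n, (1 <= n)%N -> measurable (B n).
Hypothesis hA : forall n, (1 <= n)%N -> P (A n) = pA%:E.
Hypothesis hB : forall n, (1 <= n)%N -> P (B n) = pB%:E.
Hypothesis hABind : mutually_independent P (fun n => indic_pair R A B n.+1).
Hypothesis hABU : independent_seqs P (fun n => indic_pair R A B n.+1)
  (fun n => U n.+1 : T -> R).

Local Notation q := (pair_law P A B).
Local Notation X := (state gamma x).
Local Notation trans := (move_trans gamma x q).
Local Notation H := (hist (bandit_step gamma x U A B)).

Let hpA' : 0 <= pA <= 1.
Proof. by rewrite (ltW hpA) (ltW (lt_trans hpB hpBA)). Qed.
Let hpB' : 0 <= pB <= 1.
Proof. by rewrite (ltW hpB) (ltW (lt_trans hpBA hpA)). Qed.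

Let law h m := bandit_trans_law hgamma hx hU hUind hAm hBm hABind hABU h m.
Let mstep h m := @measurable_bandit_step _ _ _ P gamma x U A B hAm hBm h m.

Lemma P_bit (D : set T) p c : measurable D -> P D = p%:E ->
  P [set w | (w \in D) = c] = (if c then p else 1 - p)%:E.
Proof.
move=> mD PD; case: c.
  by rewrite -PD; congr (P _); apply/seteqP; split=> w; [exact: set_mem|exact: mem_set].
rewrite EFinB -PD -probability_setC //; congr (P _).
by apply/seteqP; split=> w /=; [move/negbT|move=> nD; apply/negbTE]; rewrite notin_setE.
Qed.

Let q_ge0 n a b : 0 <= q n a b. Proof. exact: pair_law_ge0. Qed.

Let q_marginl n a : (1 <= n)%N ->
  q n a true + q n a false = if a then pA else 1 - pA.
Proof.
move=> n1; apply: EFin_inj; rewrite pair_law_marginl //.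
by rewrite (P_bit _ (hAm n1) (hA n1)).
Qed.

Let q_marginr n b : (1 <= n)%N ->
  q n true b + q n false b = if b then pB else 1 - pB.
Proof.
move=> n1; apply: EFin_inj; rewrite pair_law_marginr //.
by rewrite (P_bit _ (hBm n1) (hB n1)).
Qed.

Lemma ae_bounded_bandit (alive : set (seq move)) (W : seq move -> R) :
  (forall h, 0 <= W h) ->
  (forall h, alive h -> \sum_m trans h m * W (m :: h) <= W h) ->
  {ae P, forall w, (exists N, forall n, (N <= n)%N -> alive (H n w)) ->
    exists C N, forall n, (N <= n)%N -> W (H n w) <= C}.
Proof. exact: (ae_bounded mstep law). Qed.

Lemma prefix_sum_hist n w : prefix_sum gamma x (H n w) = \sum_(0 <= k < n) X (H k w).
Proof.
elim: n => [|n IH]; first by rewrite big_geq.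
by rewrite big_nat_recr //= IH.
Qed.

Lemma prefix_sum_le m n w : (m <= n)%N ->
  prefix_sum gamma x (H m w) <= prefix_sum gamma x (H n w).
Proof.
elim: n => [|n IH]; first by rewrite leqn0 => /eqP ->.
rewrite leq_eqVlt => /predU1P[->//|]; rewrite ltnS => /IH /le_trans; apply => /=.
have /andP[X0 _] := state01 hgamma hx (H n w).
by rewrite lerDl ltW.
Qed.

(** If the prefix sums were unbounded on a path tending to 0, the exponential
function would force [X / gamma] to infinity, which is the regime in which the
inverse of the state is a bounded supermartingale. *)
Lemma ae_summable :
  ((- (pA - pB))%:E <
    limn_einf (fun n => ((gamma n.+1)^-1 - (gamma n)^-1)%:E))%E ->
  {ae P, forall w, (fun n => X (H n w)) @ \oo --> 0 ->
    exists K, forall n, prefix_sum gamma x (H n w) <= K}.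
Proof.
move=> /limn_einf_gt[e [N [e0 gN]]].
pose eps := Num.min e (pA - pB).
have eps0 : 0 < eps <= pA - pB.
  by rewrite /eps lt_min e0 subr_gt0 hpBA /= ge_min lexx orbT.
have [ep0 epi] := andP eps0.
have gN' n : (N <= n)%N -> - (pA - pB) + eps <= (gamma n.+1)^-1 - (gamma n)^-1.
  by move=> /gN; apply: le_trans; rewrite lerD2l /eps ge_min lexx.
pose alive1 (h : seq move) := [/\ (0 < size h)%N, (N <= size h)%N & X h <= eps / 4].
pose alive2 (h : seq move) := gamma (size h).+1 <= (pA - pB) / 2 * X h.
have b1 : {ae P, forall w, (exists N, forall n, (N <= n)%N -> alive1 (H n w)) ->
    exists C N, forall n, (N <= n)%N -> exp_lyapunov gamma x eps (H n w) <= C}.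
  apply: (@ae_bounded_bandit alive1 (exp_lyapunov gamma x eps)) => [h|h [h0 Nh Xh]].
    exact: expR_ge0.
  by apply: (exp_drift hgamma hx hpA' hpB' q_ge0 q_marginl q_marginr) => //; exact: gN'.
have b2 : {ae P, forall w, (exists N, forall n, (N <= n)%N -> alive2 (H n w)) ->
    exists C N, forall n, (N <= n)%N -> (X (H n w))^-1 <= C}.
  apply: (@ae_bounded_bandit alive2 (fun h => (X h)^-1)) => [h|h small].
    by have /andP[X0 _] := state01 hgamma hx h; rewrite invr_ge0 ltW.
  by apply: (inv_state_drift hgamma hx hpA' hpB' q_ge0 q_marginl q_marginr).
apply: filterS2 b1 b2 => w B1 B2 X0.
have X_gt0 n : 0 < X (H n w) by have /andP[] := state01 hgamma hx (H n w).
have X_lt1 n : X (H n w) < 1 by have /andP[] := state01 hgamma hx (H n w).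
apply: contrapT => unb.
have S_unb K : exists n0, forall n, (n0 <= n)%N -> K <= prefix_sum gamma x (H n w).
  apply: contrapT => nK; apply: unb; exists K => n; apply/ltW; rewrite ltNge.
  apply/negP => Kn; apply: nK; exists n => m nm; apply: le_trans Kn _.
  exact: prefix_sum_le.
have [|C1 [N1 {}B1]] := B1.
  have [|N1 XN1] := @cvg0_le _ _ (eps / 4) X0; first by rewrite divr_gt0.
  exists (maxn 1 (maxn N N1)) => n; rewrite !geq_max => /andP[n1 /andP[Nn N1n]].
  by split; rewrite ?size_hist //; exact: XN1.
have [|C2 [N2 {}B2]] := B2.
  pose c := eps / 48; pose b := c * eps / 4.
  have c0 : 0 < c by rewrite divr_gt0.
  have b0 : 0 < b by rewrite divr_gt0 ?mulr_gt0.
  have pi0 : 0 < pA - pB by rewrite subr_gt0.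
  have [N2 SN2] := S_unb ((C1 + c * (2 / (pA - pB) + 1)) / b).
  exists (maxn 1 (maxn N (maxn N1 N2))) => n.
  rewrite !geq_max => /andP[n1 /andP[Nn /andP[N1n N2n]]].
  rewrite /alive2 size_hist.
  have /andP[g0 _] : 0 < gamma n < 1 by exact: hgamma.
  have /andP[g'0 _] : 0 < gamma n.+1 < 1 by exact: hgamma.
  have Y_large : 2 / (pA - pB) + 1 <= X (H n w) / gamma n.
    rewrite -(ler_pM2l c0).
    have := B1 _ N1n; rewrite /exp_lyapunov size_hist -/c -/b.
    have := SN2 _ N2n; rewrite ler_pdivrMr // => le1 le2.
    have := le_trans (expR_ge1Dx _) le2; lra.
  (* Passing from gamma n to gamma n.+1 costs at most pA - pB <= 1 in the ratio,
     whence the extra 1 above. *)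
  have : 2 / (pA - pB) <= X (H n w) / gamma n.+1.
    have := gN' _ Nn; rewrite -(ler_pM2r (X_gt0 n)) => step.
    have : (pA - pB) * X (H n w) <= 1.
      rewrite mulr_ile1 ?(ltW pi0) ?(ltW (X_gt0 n)) ?(ltW (X_lt1 n)) //.
      by move: hpA hpB; lra.
    have : 0 <= eps * X (H n w) by rewrite mulr_ge0 ?ltW.
    lra.
  rewrite ler_pdivrMr // mulrAC ler_pdivlMr // => le.
  by rewrite mulrAC ler_pdivlMr //; lra.
have C2_gt0 : 0 < C2.
  by apply: lt_le_trans (B2 _ (leqnn N2)); rewrite invr_gt0.
have [|N3 XN3] := @cvg0_le _ _ (C2^-1 / 2) X0; first by rewrite divr_gt0 ?invr_gt0.
have := B2 _ (leq_maxl N2 N3); rewrite invf_ple ?posrE //.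
have := XN3 _ (leq_maxr N2 N3).
have : 0 < C2^-1 by rewrite invr_gt0.
lra.
Qed.

Lemma ae_finitely_many_jumps :
  {ae P, forall w, (exists K, forall n, prefix_sum gamma x (H n w) <= K) ->
    exists N, forall n, (N <= n)%N -> ~~ (U n.+1 w <= X (H n w))}.
Proof.
have cb (K : nat) : {ae P, forall w,
    (exists N, forall n, (N <= n)%N ->
       prefix_sum gamma x (H n w) + X (H n w) <= K%:R) ->
    exists C N, forall n, (N <= n)%N -> count_lyapunov gamma x K%:R (H n w) <= C}.
  apply: (@ae_bounded_bandit (fun h => prefix_sum gamma x h + X h <= K%:R)
    (count_lyapunov gamma x K%:R)) => h.
    rewrite addr_ge0 //; last by rewrite le_max lexx.
    by elim: h => //= m h IH; rewrite addr_ge0.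
  by apply: (count_drift hgamma hx q_ge0 q_marginl q_marginr).
apply: filterS (ae_foralln cb) => w cbw [K SK].
have [|C [N CN]] := cbw (Num.truncn K).+1.
  exists 0%N => n _; apply/ltW/(le_lt_trans (SK n.+1)); exact: truncnS_gt.
have {CN} count_le n : (N <= n)%N -> count_jump R (H n w) <= C.
  by move=> /CN; apply: le_trans; rewrite lerDl le_max lexx.
apply: contrapT => inf_jumps.
have jump n : exists2 m, (n <= m)%N & U m.+1 w <= X (H m w).
  apply: contrapT => nj; apply: inf_jumps; exists n => m nm.
  by apply/negP => Um; apply: nj; exists m.
have count_mono m n : (m <= n)%N -> count_jump R (H m w) <= count_jump R (H n w).
  elim: n => [|n IH]; first by rewrite leqn0 => /eqP ->.
  rewrite leq_eqVlt => /predU1P[->//|]; rewrite ltnS => /IH /le_trans; apply.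
  by rewrite /= lerDl.
have unb (j : nat) : exists2 n, (N <= n)%N & j%:R <= count_jump R (H n w).
  elim: j => [|j [n Nn jn]].
    by exists N => //; elim: (N) => //= k IH; rewrite addr_ge0.
  have [m nm Um] := jump n; exists m.+1; first by rewrite ltnW // ltnS (leq_trans Nn).
  rewrite /= size_hist Um /= -natr1 lerD2r; apply: le_trans jn _; exact: count_mono.
have [n Nn] := unb (Num.truncn C).+1; rewrite leNgt => /negP; apply.
by apply: le_lt_trans (count_le _ Nn) _; exact: truncnS_gt.
Qed.

Local Notation Pi := (path_loss_prod gamma B).

Lemma eventually_product w :
  (exists N, forall n, (N <= n)%N -> ~~ (U n.+1 w <= X (H n w))) ->
  exists n0 : nat, (1 <= n0)%N /\ forall n, (n0 <= n)%N ->
    X (H n w) = X (H n0 w) * \prod_(n0.+1 <= k < n.+1) (1 - \1_(B k) w * gamma k).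
Proof.
move=> [N nojump]; exists N.+1; split=> // n.
elim: n => // n IH; rewrite leq_eqVlt => /predU1P[<-|].
  by rewrite big_geq ?mulr1.
rewrite ltnS => Nn; rewrite big_nat_recr //= mulrA -IH //.
rewrite /bandit_step size_hist (negbTE (nojump _ (ltnW Nn))) /= mul0r sub0r indicE.
by ring.
Qed.

Let X_gt0 h : 0 < X h. Proof. by have /andP[] := state01 hgamma hx h. Qed.
Let X_lt1 h : X h < 1. Proof. by have /andP[] := state01 hgamma hx h. Qed.

Let factor_gt0 k w : (1 <= k)%N -> 0 < 1 - \1_(B k) w * gamma k.
Proof.
move=> /hgamma/andP[g0 g1]; rewrite indicE.
by case: (w \in B k); rewrite ?mul1r ?mul0r ?subr0 ?subr_gt0.
Qed.

Let Pi_gt0 n w : 0 < Pi n w.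
Proof.
rewrite /path_loss_prod big_nat_cond; apply: prodr_gt0 => k /andP[/andP[k1 _] _].
exact: factor_gt0.
Qed.

Let PiS n w : Pi n.+1 w = Pi n w * (1 - \1_(B n.+1) w * gamma n.+1).
Proof. by rewrite /path_loss_prod big_nat_recr. Qed.

Lemma product_ratio w n0 : (forall n, (n0 <= n)%N ->
    X (H n w) = X (H n0 w) * \prod_(n0.+1 <= k < n.+1) (1 - \1_(B k) w * gamma k)) ->
  forall n, (n0 <= n)%N -> X (H n w) = X (H n0 w) / Pi n0 w * Pi n w.
Proof.
move=> Xn n n0n; rewrite Xn //.
have -> : Pi n w = Pi n0 w * \prod_(n0.+1 <= k < n.+1) (1 - \1_(B k) w * gamma k).
  by rewrite /path_loss_prod (big_cat_nat (n := n0.+1)).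
by rewrite mulrA divfK // gt_eqF // Pi_gt0.
Qed.

(** After the last jump the products are proportional to the states. *)
Lemma bounded_product_sums w :
  (exists K, forall n, prefix_sum gamma x (H n w) <= K) ->
  (exists N, forall n, (N <= n)%N -> ~~ (U n.+1 w <= X (H n w))) ->
  bounded_sums (fun n => Pi n w).
Proof.
move=> [K SK] /eventually_product[n0 [n01 /product_ratio Xn]].
apply: (@bounded_sums_dom _ _ (fun n => X (H n w)) (Pi n0 w / X (H n0 w)) n0).
- by move=> n _; exact: ltW.
- by rewrite divr_ge0 // ltW.
- move=> n n0n _; rewrite (Xn n) // le_eqVlt; apply/orP; left; apply/eqP.
  by field; rewrite !gt_eqF.
exists K => n; apply: le_trans (SK n.+1); rewrite prefix_sum_hist.
by rewrite [leRHS]big_ltn // lerDr ltW.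
Qed.

(** * Paths without jumps *)

(** The path obtained by suppressing all jumps reads the bits only, so that it is
independent of the thresholds. *)
Definition null_step (h : seq move) (w : T) : move :=
  (false, w \in A (size h).+1, w \in B (size h).+1).

Local Notation H0 := (hist null_step).

Lemma measurable_null_step h m : measurable [set w | null_step h w = m].
Proof.
case: m => -[[] a] b.
  by rewrite (_ : [set w | _] = set0) //; apply/seteqP; split=> w.
rewrite (_ : [set w | _] =
  [set w | (w \in A (size h).+1) = a /\ (w \in B (size h).+1) = b]).
  exact: measurable_pair_event.
by apply/seteqP; split=> w; rewrite /null_step /= => -[-> ->].
Qed.

Lemma state_null_hist n w : X (H0 n w) = x * Pi n w.
Proof.
elim: n => [|n IH]; first by rewrite /path_loss_prod big_geq ?mulr1.
by rewrite PiS /= size_hist IH mul0r sub0r indicE; ring.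
Qed.

Lemma prefix_sum_null_hist n w :
  prefix_sum gamma x (H0 n.+1 w) = x * (1 + \sum_(1 <= k < n.+1) Pi k w).
Proof.
elim: n => [|n IH]; first by rewrite /= big_geq // add0r addr0 mulr1.
rewrite -[LHS]/(prefix_sum gamma x (H0 n.+1 w) + X (H0 n.+1 w)).
by rewrite IH (state_null_hist n.+1) -mulrDr [in RHS]big_nat_recr //= addrA.
Qed.

Lemma hist_null n w : all (fun m : move => ~~ m.1.1) (H n w) -> H n w = H0 n w.
Proof.
elim: n => //= n IH /andP[nu /IH Hn].
by rewrite -Hn /null_step /bandit_step in nu *; rewrite (negbTE nu).
Qed.

Lemma null_hist_all n w : all (fun m : move => ~~ m.1.1) (H0 n w).
Proof. by elim: n. Qed.

Lemma null_hist_pair_event n w : pair_event R A B (H0 n w) w.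
Proof.
rewrite /pair_event size_hist; elim: n => [|n IH] k //=.
rewrite ltnS leq_eqVlt size_hist; case: eqVneq => [-> _|_ /= kn].
  by rewrite /indic_pair !indicE.
exact: IH.
Qed.

Lemma measurable_pair_rectangle h : measurable (pair_event R A B h).
Proof.
apply: fin_bigcap_measurable => [|k _]; first exact: finite_II.
elim: h => [|[[u a] b] h IH] /=; first by rewrite preimage_setT.
by case: eqP => // _; rewrite indic_pair_preimage; exact: measurable_pair_event.
Qed.

(** Along a history without jumps the thresholds contribute the product of the
factors [1 - X], and [1 - X >= expR (- X / (1 - X))] with [X <= x]. *)
Lemma threshold_event_null h : all (fun m : move => ~~ m.1.1) h ->
  X h <= x /\
  ((expR (- (prefix_sum gamma x h / (1 - x))))%:E <=
   P (threshold_event gamma x U h))%E.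
Proof.
have [x0 x1] := andP hx.
elim: h => [_|[[u a] b] h IH /= /andP[/negbTE -> /IH[Xx Ph]]].
  split=> //; rewrite mul0r oppr0 expR0 /threshold_event /= II0 bigcap_set0.
  by rewrite probability_setT.
have /andP[g0 g1] : 0 < gamma (size h).+1 < 1 by exact: hgamma.
split.
  rewrite mul0r sub0r mulrN; apply: le_trans Xx; rewrite lerBlDr lerDl.
  by rewrite !mulr_ge0 // ltW.
rewrite P_threshold_event_cons //= mulrDl opprD expRD EFinM.
apply: lee_pmul => //; rewrite ?lee_fin ?expR_ge0 //.
have X1 : 0 < 1 - X h by rewrite subr_gt0.
apply: (@le_trans _ _ (expR (- (X h / (1 - X h))))).
  rewrite ler_expR lerN2 ler_wpM2l ?(ltW (X_gt0 h)) // lef_pV2 ?posrE ?subr_gt0 //.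
  by rewrite lerD2l lerN2.
rewrite expRN -[leRHS]invrK lef_pV2 ?posrE ?invr_gt0 ?expR_gt0 //.
apply: le_trans (expR_ge1Dx _).
by rewrite (_ : 1 + X h / _ = (1 - X h)^-1) //; field; rewrite gt_eqF.
Qed.

Let small_sum K n := [set w | prefix_sum gamma x (H0 n w) <= K].
Let no_jump n := [set w | H n w = H0 n w].

Let measurable_small_sum K n : measurable (small_sum K n).
Proof.
exact: (measurable_hist measurable_null_step n (fun h => prefix_sum gamma x h <= K)).
Qed.

Let measurable_no_jump n : measurable (no_jump n).
Proof.
rewrite (_ : no_jump n = [set w | all (fun m : move => ~~ m.1.1) (H n w)]).
  exact: (measurable_hist mstep n (fun h => all (fun m : move => ~~ m.1.1) h)).
apply/seteqP; split=> w; rewrite /no_jump /=; last exact: hist_null.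
by move=> ->; exact: null_hist_all.
Qed.

(** Summed over the histories without jumps: each has the probability of its
bits multiplied by that of its threshold constraints. *)
Lemma P_no_jump_ge K n :
  ((expR (- (K / (1 - x))))%:E * P (small_sum K n) <=
   P (small_sum K n `&` no_jump n))%E.
Proof.
pose f w : n.-tuple move := Tuple (introT eqP (size_hist null_step n w)).
have fE w s : f w = s <-> H0 n w = s.
  split=> [<- //|H0s]; exact: val_inj.
have m_f s : measurable [set w | f w = s].
  rewrite (_ : [set w | _] = [set w | H0 n w = s]).
    exact: (measurable_hist measurable_null_step n (fun h => h = s)).
  by apply/seteqP; split=> w /fE.
rewrite (@P_disintegrate _ _ _ P _ f (small_sum K n)); last first.
  by move=> s; exact: measurableI.
rewrite (@P_disintegrate _ _ _ P _ f (small_sum K n `&` _)); last first.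
  by move=> s; apply: measurableI => //; exact: measurableI.
rewrite ge0_sume_distrr //; apply: lee_sum => s _.
have [/andP[s_null sK]|bad] :=
    boolP (all (fun m : move => ~~ m.1.1) s && (prefix_sum gamma x s <= K)); last first.
  rewrite (_ : small_sum K n `&` _ = set0) ?measure0 ?mule0 //.
  apply/seteqP; split=> // w [small /fE H0s]; move: bad small.
  by rewrite /small_sum /= -H0s null_hist_all /= => /negbTE ->.
have size_s : size s = n by rewrite size_tuple.
have [_ Pth] := threshold_event_null s_null.
apply: (@le_trans _ _ (P (cylinder (bandit_step gamma x U A B) s))).
  rewrite (P_cylinder_split gamma x hABU) muleC.
  apply: lee_pmul => //.
    apply: le_measure; rewrite ?inE; first exact: measurableI.
      exact: measurable_pair_rectangle.
    by move=> w [_ /fE <-]; exact: null_hist_pair_event.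
  apply: le_trans Pth; rewrite lee_fin ler_expR lerN2 ler_wpM2r //.
  by rewrite invr_ge0 subr_ge0 ltW //; have [] := andP hx.
apply: le_measure; rewrite ?inE; first exact: (measurable_cylinder mstep).
  by apply: measurableI => //; exact: measurableI.
move=> w; rewrite /cylinder /= size_s => Hs.
have H0s : H0 n w = s by rewrite -hist_null // Hs.
by split; [split; rewrite /small_sum /no_jump /= H0s|exact/fE].
Qed.

Lemma bounded_sums_bigcup :
  [set w | bounded_sums (fun n => Pi n w)] =
  \bigcup_K \bigcap_n small_sum K%:R n.
Proof.
have [x0 _] := andP hx.
apply/seteqP; split=> w /=.
  move=> [C SC]; exists (Num.truncn (x * (1 + C))).+1 => // -[|n] _.
    by rewrite /small_sum /= ler0n.
  rewrite /small_sum /mkset prefix_sum_null_hist.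
  apply: (@le_trans _ _ (x * (1 + C))); last exact/ltW/truncnS_gt.
  by rewrite ler_wpM2l ?(ltW x0) // lerD2l.
move=> [K _ SK]; exists (K%:R / x) => n; have := SK n.+1 I.
rewrite /small_sum /mkset prefix_sum_null_hist => le.
rewrite ler_pdivlMr // mulrC; by apply: le_trans le; rewrite ler_wpM2l ?(ltW x0) // lerDr.
Qed.

Lemma measurable_bounded_sums :
  measurable [set w | bounded_sums (fun n => Pi n w)].
Proof.
rewrite bounded_sums_bigcup.
by apply: bigcupT_measurable => K; exact: bigcapT_measurable.
Qed.

(** The lower bound of [P_no_jump_ge] is uniform in the number of steps, so it
survives in the limit. *)
Lemma prob_zero_gt0 (Xinf : T -> R) : measurable [set w | Xinf w = 0] ->
  {ae P, forall w, (fun n => X (H n w)) @ \oo --> Xinf w} ->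
  (0 < P [set w | bounded_sums (fun n => Pi n w)])%E ->
  (0 < P [set w | Xinf w = 0%R])%E.
Proof.
move=> mZ cvX PS.
have mD (K : nat) : measurable (\bigcap_n small_sum K%:R n).
  exact: bigcapT_measurable.
have [K PK] : exists K : nat, (0 < P (\bigcap_n small_sum K%:R n))%E.
  apply: contrapT => nK; move: PS; rewrite bounded_sums_bigcup.
  rewrite measure_negligible ?ltxx //; first exact: bigcupT_measurable.
  apply: negligible_bigcup => K; apply/negligibleP => //; apply/eqP.
  by rewrite -measure_le0 leNgt; apply/negP => ?; apply: nK; exists K.
pose G n := small_sum K%:R n `&` no_jump n.
have mG n : measurable (G n) by exact: measurableI.
apply: (@lt_le_trans _ _ (P (\bigcap_n G n))); last first.
  apply: ae_le_measure => //; first exact: bigcapT_measurable.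
  apply: filterS cvX => w Xw Gw.
  have bPi : bounded_sums (fun n => Pi n w).
    suff : [set w | bounded_sums (fun n => Pi n w)] w by [].
    by rewrite bounded_sums_bigcup; exists K => // n _; case: (Gw n I).
  apply: cvg_unique Xw _ => //.
  rewrite (_ : (fun n => _) = (fun n => x * Pi n w)); last first.
    by apply/funext => n; have [_ /= ->] := Gw n I; exact: state_null_hist.
  rewrite -[0](mulr0 x); apply: cvgM; first exact: cvg_cst.
  by apply: bounded_sums_cvg0 => // n _; exact: ltW.
apply: (@lt_le_trans _ _ ((expR (- (K%:R / (1 - x))))%:E *
    P (\bigcap_n small_sum K%:R n))%E).
  by rewrite mule_gt0 // lte_fin expR_gt0.
apply: measure_bigcap_ge => // [|n].
  apply/nonincreasing_seqP => n; apply/subsetPset => w [small eqH]; split.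
    apply: le_trans small => /=; rewrite lerDl; exact: ltW.
  by move: eqH; rewrite /no_jump /= => -[].
apply: le_trans (P_no_jump_ge _ _); rewrite lee_pmul2l ?lte_fin ?expR_gt0 //.
by apply: le_measure; rewrite ?inE // => w; exact.
Qed.

Lemma loss_prod_hist n w : loss_prod gamma (H n w) = Pi n w.
Proof.
elim: n => [|n IH]; first by rewrite /path_loss_prod big_geq.
by rewrite PiS /= size_hist IH indicE.
Qed.

Lemma loss_prod_sum_hist n w :
  loss_prod_sum gamma (H n w) = \sum_(1 <= k < n.+1) Pi k w.
Proof.
elim: n => [|n IH]; first by rewrite big_geq.
by rewrite big_nat_recr // -IH -(loss_prod_hist n.+1).
Qed.

Lemma ae_bounded_product_sums : bounded_sums (mean_prod gamma pB) ->
  {ae P, forall w, bounded_sums (fun n => Pi n w)}.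
Proof.
move=> [sigma le_sigma].
have loss_prod_gt0 h : 0 < loss_prod gamma h.
  elim: h => //= -[[u a] b] h IH; rewrite mulr_gt0 //= subr_gt0.
  have /andP[g0 g1] : 0 < gamma (size h).+1 < 1 by exact: hgamma.
  by case: b; rewrite ?mul1r ?mul0r.
have loss_ge0 h : 0 <= loss_prod gamma h *
    ((sigma - \sum_(1 <= k < (size h).+1) mean_prod gamma pB k) /
      mean_prod gamma pB (size h)).
  rewrite mulr_ge0 ?(ltW (loss_prod_gt0 h)) // divr_ge0 ?subr_ge0 //.
  exact/ltW/(mean_prod_gt0 hgamma hpB').
have := @ae_bounded_bandit setT (loss_lyapunov gamma pB sigma) _ _.
have H1 h : 0 <= loss_lyapunov gamma pB sigma h.
  rewrite addr_ge0 //; elim: h => //= m h IH.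
  rewrite addr_ge0 //; exact: ltW (loss_prod_gt0 (m :: h)).
have H2 h : setT h -> \sum_m trans h m * loss_lyapunov gamma pB sigma (m :: h) <=
    loss_lyapunov gamma pB sigma h.
  by move=> _; rewrite (loss_drift _ hgamma hpB' q_marginr).
move=> /(_ H1 H2); apply: filterS => w [|C [N WC]]; first by exists 0%N.
have SC n : (N <= n)%N -> \sum_(1 <= k < n.+1) Pi k w <= C.
  by move=> /WC; apply: le_trans; rewrite -loss_prod_sum_hist lerDl.
exists C => n; have [nN|/ltnW] := leqP n N; last exact: SC.
apply: le_trans (SC N (leqnn N)); rewrite [leRHS](big_cat_nat (n := n.+1)) //=.
by rewrite lerDl sumr_ge0 // => k _; exact: ltW.
Qed.

(** * Square-summable steps *)

(** This is Kolmogorov's inequality, obtained from the root history. *)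
Lemma walk_maximal (c : nat -> R) (sigma lam : R) : 0 < lam ->
  (forall n, \sum_(1 <= k < n.+1) c k ^+ 2 <= sigma) ->
  exists E, [/\ measurable E, (P E <= (sigma / lam)%:E)%E &
    forall w n, lam <= loss_walk pB c (H n w) ^+ 2 -> E w].
Proof.
move=> lam0 c_sigma; set W := walk_lyapunov pB c sigma.
have W_ge h : loss_walk pB c h ^+ 2 <= W h by rewrite lerDl subr_ge0.
have W0 h : 0 <= W h by apply: le_trans (W_ge h); exact: sqr_ge0.
have W_super h : setT h -> \sum_m trans h m * W (m :: h) <= W h.
  by move=> _; apply: walk_drift => //; exact: q_marginr.
pose hit := hits (bandit_step gamma x U A B) setT W lam.
exists (cylinder (bandit_step gamma x U A B) [::] `&` \bigcup_k hit k 0%N); split.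
- apply: measurableI; first exact: (measurable_cylinder mstep).
  by apply: bigcupT_measurable => k; exact: (measurable_hits mstep).
- apply: le_trans (maximal_inequality mstep law W0 W_super [::] lam0) _.
  rewrite (_ : cylinder _ _ = setT); last exact/seteqP.
  by rewrite probability_setT mul1e /W /walk_lyapunov /= big_geq // subr0 expr0n add0r.
- move=> w n le; split; first by [].
  exists n => //; apply: hitsP => //; rewrite add0n; exact: le_trans le (W_ge _).
Qed.

Lemma loss_walk_hist c n w :
  loss_walk pB c (H n w) = \sum_(1 <= k < n.+1) c k * (pB - \1_(B k) w).
Proof.
elim: n => [|n IH]; first by rewrite big_geq.
by rewrite big_nat_recr // -IH /= size_hist indicE.
Qed.

(** Kolmogorov's inequality for the walk whose first [N] steps are suppressed
controls the oscillation after time [N] by the tail of the series. *)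
Lemma ae_cvg_walk (c : nat -> R) : bounded_sums (fun k => c k ^+ 2) ->
  {ae P, forall w, cvgn (fun n => loss_walk pB c (H n w))}.
Proof.
move=> bc; pose M n w := loss_walk pB c (H n w).
have cauchy (j : nat) : {ae P, forall w,
    exists N, forall n, (N <= n)%N -> `|M n w - M N w| < j.+1%:R^-1}.
  apply: negligible_small => e e0.
  pose lam : R := j.+1%:R^-1 ^+ 2.
  have lam0 : 0 < lam by rewrite exprn_gt0 // invr_gt0.
  have [|N cN] := bounded_sums_tail _ bc (mulr_gt0 e0 lam0).
    by move=> n _; exact: sqr_ge0.
  pose c' k := if (k <= N)%N then 0 else c k.
  have c'E n : (N <= n)%N ->
      \sum_(1 <= k < n.+1) c' k ^+ 2 = \sum_(N.+1 <= k < n.+1) c k ^+ 2.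
    move=> Nn; rewrite (big_cat_nat (n := N.+1)) //= big_nat_cond big1 ?add0r.
      rewrite big_nat_cond [RHS]big_nat_cond; apply: eq_bigr => k.
      by rewrite /c' andbT => /andP[Nk _]; rewrite leqNgt Nk.
    by move=> k; rewrite /c' ltnS andbT => /andP[_ ->]; rewrite expr0n.
  have [n|E [mE PE inE]] := @walk_maximal c' (e * lam) lam lam0.
    have [Nn|nN] := leqP N n; first by rewrite c'E // cN.
    rewrite big_nat_cond big1 ?mulr_ge0 ?(ltW e0) ?(ltW lam0) // => k.
    by rewrite ltnS andbT /c' => /andP[_ kn]; rewrite (leq_trans kn (ltnW nN)) expr0n.
  exists E; split=> //; last by rewrite mulfK ?gt_eqF // in PE.
  move=> w /= nN; have [n Nn] : exists2 n, (N <= n)%N & j.+1%:R^-1 <= `|M n w - M N w|.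
    apply: contrapT => small; apply: nN; exists N => n Nn; rewrite ltNge.
    by apply/negP => le; apply: small; exists n.
  move=> big_n; apply: (inE w n).
  have -> : loss_walk pB c' (H n w) = M n w - M N w.
    rewrite /M !loss_walk_hist (big_cat_nat (n := N.+1) (p := n.+1)) //=.
    rewrite [X in _ = X - _](big_cat_nat (n := N.+1)) //= addrAC subrr add0r.
    rewrite big_nat_cond big1 ?add0r => [|k]; last first.
      by rewrite /c' ltnS andbT => /andP[_ ->]; rewrite mul0r.
    rewrite big_nat_cond [RHS]big_nat_cond; apply: eq_bigr => k.
    by rewrite /c' andbT => /andP[Nk _]; rewrite leqNgt Nk.
  by rewrite -real_normK ?num_real // ler_sqr ?nnegrE ?invr_ge0.
by apply: filterS (ae_foralln cauchy) => w; exact: cauchy_seq_cvg.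
Qed.

(** The logarithm of the ratio is a convergent walk minus a convergent monotone
series. *)
Lemma ae_product_equiv : bounded_sums (fun k => gamma k ^+ 2) ->
  {ae P, forall w, exists2 L : R, 0 < L &
    (fun n => Pi n w / mean_prod gamma pB n) @ \oo --> L}.
Proof.
move=> bg; pose f k := (gamma k / (1 - gamma k)) ^+ 2.
have bf : bounded_sums f.
  have g2 : (fun k => gamma k ^+ 2) @ \oo --> 0.
    by apply: bounded_sums_cvg0 bg => n _; exact: sqr_ge0.
  have [|N gN] := @cvg0_le _ _ 4^-1 g2; first by [].
  apply: (@bounded_sums_dom _ _ (fun k => gamma k ^+ 2) 4 N) => //.
    by move=> n _; exact: sqr_ge0.
  move=> n /gN g4 n1; have /andP[g0 g1] : 0 < gamma n < 1 by exact: hgamma.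
  have g12 : gamma n <= 2^-1.
    by rewrite -ler_sqr ?nnegrE ?(ltW g0) // (le_trans g4) // expr2 -invfM -natrM.
  rewrite /f expr_div_n mulrC ler_wpM2r ?sqr_ge0 //.
  rewrite -[leRHS]invrK lef_pV2 ?posrE ?exprn_gt0 ?subr_gt0 //.
  by nra.
pose c k := gamma k / (1 - pB * gamma k).
have bc : bounded_sums (fun k => c k ^+ 2).
  apply: (@bounded_sums_dom _ _ f 1 0) => // [n _|n _ n1]; first exact: sqr_ge0.
  have /andP[g0 g1] : 0 < gamma n < 1 by exact: hgamma.
  have [p0 p1] := andP hpB'.
  have pg : 1 - gamma n <= 1 - pB * gamma n.
    by rewrite lerD2l lerN2 ler_piMl // ltW.
  have g'0 : 0 < 1 - gamma n by rewrite subr_gt0.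
  have pg0 := lt_le_trans g'0 pg.
  rewrite mul1r /f /c ler_sqr ?nnegrE ?divr_ge0 ?(ltW g0) ?(ltW pg0) ?(ltW g'0) //.
  by rewrite ler_wpM2l ?(ltW g0) // lef_pV2.
apply: filterS (ae_cvg_walk bc) => w cvM.
pose m k := c k * (pB - \1_(B k) w).
have mP k : (1 <= k)%N ->
    [/\ 1 + m k = (1 - \1_(B k) w * gamma k) / (1 - pB * gamma k), 0 < 1 + m k &
      0 <= m k - ln (1 + m k) <= f k].
  by move=> k1; rewrite /m /c indicE; exact: log_loss_bound (hgamma k1).
pose r k := m k - ln (1 + m k).
have cvr : cvgn (fun n => \sum_(1 <= k < n.+1) r k).
  apply: bounded_sums_is_cvg => [n /mP[_ _ /andP[]] //|].
  apply: (@bounded_sums_dom _ _ f 1 0) => // [n _|n _ n1]; first exact: sqr_ge0.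
  by rewrite mul1r; have [_ _ /andP[]] := mP n n1.
exists (expR (limn (fun n => loss_walk pB c (H n w)) -
    limn (fun n => \sum_(1 <= k < n.+1) r k))); first exact: expR_gt0.
rewrite (_ : (fun n => _) = expR \o (fun n => loss_walk pB c (H n w) -
    \sum_(1 <= k < n.+1) r k)).
  apply: continuous_cvg; first exact: continuous_expR.
  exact: cvgB.
apply/funext => n /=; rewrite loss_walk_hist; elim: n => [|n IH].
  by rewrite /path_loss_prod /mean_prod !big_geq // subrr expR0 divr1.
have [mE m0 _] := mP n.+1 isT.
rewrite PiS mean_prodS -mulf_div IH -mE -[in LHS](lnK m0) -expRD.
rewrite !(@big_nat_recr _ _ _ n.+1) //= /r /m; congr expR; ring.
Qed.

Lemma mean_bounded_sums (w : T) (L : R) : 0 < L ->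
  (fun n => Pi n w / mean_prod gamma pB n) @ \oo --> L ->
  bounded_sums (fun n => Pi n w) -> bounded_sums (mean_prod gamma pB).
Proof.
move=> L0 cvL; have mp0 n : 0 < mean_prod gamma pB n.
  exact: (mean_prod_gt0 hgamma hpB').
have [N _ LN] : \forall n \near \oo, L / 2 <= Pi n w / mean_prod gamma pB n.
  by apply: (cvgr_ge L) => //; lra.
apply: (@bounded_sums_dom _ _ _ (2 / L) N).
- by move=> n _; exact: ltW.
- by rewrite divr_ge0 // ltW.
- move=> n /LN /=; rewrite ler_pdivlMr // => le _.
  by rewrite mulrAC ler_pdivlMr // mulrC; move: le; lra.
Qed.

Lemma measurable_state n : measurable_fun setT (fun w => X (H n w)).
Proof.
move=> _ Y mY; rewrite setTI.
exact: (measurable_hist mstep n (fun h => Y (X h))).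
Qed.

(** The upper limit is a measurable choice of the limit where the latter exists,
and the value 1 elsewhere makes it positive everywhere. *)
Lemma ratio_limit : exists Xi : {RV P >-> R}, (forall w, 0 < Xi w) /\
  forall w (L : R), 0 < L ->
    (fun n => X (H n w) / mean_prod gamma pB n) @ \oo --> L -> Xi w = L.
Proof.
pose ratio n w := (X (H n w) / mean_prod gamma pB n)%:E.
pose l := fine \o (fun w => limn_esup (ratio ^~ w)).
pose xi w := if 0 < l w then l w else 1.
have mlim : @measurable_fun _ _ T (\bar R) setT (fun w => limn_esup (ratio ^~ w)).
  apply: (@measurable_fun_limn_esup _ _ _ setT ratio) => n; apply/measurable_EFinP.
  by apply: measurable_funM => //; exact: measurable_state.
have ml : measurable_fun setT l.
  exact: (measurableT_comp (@fine_measurable R setT measurableT) mlim).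
have mxi : measurable_fun setT xi.
  apply: measurable_fun_ifT => //.
  exact: measurable_fun_ltr.
pose Xi : {mfun T >-> R} := HB.pack xi (isMeasurableFun.Build _ _ _ _ xi mxi).
exists Xi; split=> [w|w L L0 cvL].
  by rewrite /= /xi; case: ifP.
rewrite /= /xi /l /= (@cvg_limn_einf_sup _ _ L%:E _).2 /= ?L0 //.
by apply: cvg_EFin => //; exact: nearW.
Qed.
End Bandit.

Theorem proposition3 (R : realType) (d : measure_display) (T : measurableType d)
    (P : probability T R)
    (pA pB : R) (gamma : nat -> R) (U : nat -> {RV P >-> R})
    (A B : nat -> set T) (x : R) (Xinf : {RV P >-> R})
    (hpB : 0 < pB) (hpBA : pB < pA) (hpA : pA < 1)
    (hgamma : forall n, (1 <= n)%N -> 0 < gamma n < 1)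
    (hGamma : (fun n => \sum_(1 <= k < n.+1) gamma k) @ \oo --> +oo)
    (hU : forall n, (1 <= n)%N -> forall E : set R, measurable E ->
      distribution P (U n) E = uniform_prob (@ltr01 R) E)
    (hUind : mutually_independent P (fun n => U n.+1 : T -> R))
    (hAm : forall n, (1 <= n)%N -> measurable (A n))
    (hBm : forall n, (1 <= n)%N -> measurable (B n))
    (hA : forall n, (1 <= n)%N -> P (A n) = pA%:E)
    (hB : forall n, (1 <= n)%N -> P (B n) = pB%:E)
    (hABind : mutually_independent P (fun n => indic_pair R A B n.+1))
    (hABU : independent_seqs P (fun n => indic_pair R A B n.+1)
      (fun n => U n.+1 : T -> R))
    (hx : 0 < x < 1)
    (hXinf : {ae P, forall w,
      (fun n => bandit gamma U A B x n w) @ \oo --> Xinf w})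
    (hliminf : ((- (pA - pB))%:E <
      limn_einf (fun n => ((gamma n.+1)^-1 - (gamma n)^-1)%:E))%E) :
  [/\ (0 < P [set w | Xinf w = 0%R])%E <->
      (0 < P [set w |
        (\sum_(1 <= n <oo)
          (\prod_(1 <= k < n.+1) (1 - \1_(B k) w * gamma k))%R%:E < +oo)%E])%E,
      {ae P, forall w, Xinf w = 0 ->
        exists n0 : nat, (1 <= n0)%N /\
          forall n, (n0 <= n)%N ->
            bandit gamma U A B x n w =
            bandit gamma U A B x n0 w *
              \prod_(n0.+1 <= k < n.+1) (1 - \1_(B k) w * gamma k)}
    & (\sum_(1 <= n <oo)
        (\prod_(1 <= k < n.+1) (1 - pB * gamma k))%R%:E < +oo)%E ->
      (0 < P [set w | Xinf w = 0%R])%E] /\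
  ((\sum_(1 <= n <oo) (gamma n ^+ 2)%R%:E < +oo)%E ->
      ((0 < P [set w | Xinf w = 0%R])%E <->
       (\sum_(1 <= n <oo)
         (\prod_(1 <= k < n.+1) (1 - pB * gamma k))%R%:E < +oo)%E) /\
      exists Xi : {RV P >-> R}, (forall w, 0 < Xi w) /\
        {ae P, forall w, Xinf w = 0 ->
          (fun n => bandit gamma U A B x n w) ~_\oo
          (fun n => Xi w * \prod_(1 <= k < n.+1) (1 - pB * gamma k))}).
Proof.
have hpA' : 0 <= pA <= 1 by rewrite (ltW hpA) (ltW (lt_trans hpB hpBA)).
have hpB' : 0 <= pB <= 1 by rewrite (ltW hpB) (ltW (lt_trans hpBA hpA)).
pose X n w := state gamma x (hist (bandit_step gamma x U A B) n w).
have bE w : (fun n => bandit gamma U A B x n w) = X ^~ w.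
  by apply/funext => n; exact: bandit_hist.
have X_gt0 n w : 0 < X n w.
  by have /andP[] := state01 hgamma hx (hist (bandit_step gamma x U A B) n w).
have factor_gt0 (p : R) k : 0 <= p <= 1 -> (1 <= k)%N -> 0 < 1 - p * gamma k.
  move=> /andP[p0 p1] k1; have /andP[g0 g1] := hgamma _ k1.
  by rewrite subr_gt0 (le_lt_trans _ g1) // ler_piMl // ltW.
have prod_gt0 (u : nat -> R) n : (forall k, (1 <= k)%N -> 0 <= u k <= 1) ->
    0 < \prod_(1 <= k < n.+1) (1 - u k * gamma k).
  move=> u01; rewrite big_nat_cond; apply: prodr_gt0 => k /andP[/andP[k1 _] _].
  by apply: factor_gt0 => //; exact: u01.
have ind01 k w : 0 <= (\1_(B k) w : R) <= 1 by rewrite indicE ler0n lern1 leq_b1.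
have PiE w : (\sum_(1 <= n <oo)
    (\prod_(1 <= k < n.+1) (1 - \1_(B k) w * gamma k))%R%:E < +oo)%E <->
    bounded_sums (path_loss_prod gamma B ^~ w).
  by apply: nneseries_lt_pinftyP => n _; exact/ltW/prod_gt0.
have meanE : (\sum_(1 <= n <oo)
    (\prod_(1 <= k < n.+1) (1 - pB * gamma k))%R%:E < +oo)%E <->
    bounded_sums (mean_prod gamma pB).
  by apply: nneseries_lt_pinftyP => n _; exact/ltW/prod_gt0.
have -> : [set w | (\sum_(1 <= n <oo)
    (\prod_(1 <= k < n.+1) (1 - \1_(B k) w * gamma k))%R%:E < +oo)%E] =
    [set w | bounded_sums (path_loss_prod gamma B ^~ w)].
  by apply/seteqP; split=> w /PiE.
set S := [set w | bounded_sums _].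
have mS : measurable S := measurable_bounded_sums gamma hx hAm hBm.
have mZ : measurable [set w | Xinf w = 0].
  rewrite -[X in measurable X]setTI.
  exact: (@measurable_funPT _ _ _ _ Xinf measurableT _ (measurable_set1 0)).
have cvX : {ae P, forall w, X ^~ w @ \oo --> Xinf w}.
  by apply: filterS hXinf => w; rewrite bE.
have ae_prod : {ae P, forall w, Xinf w = 0 -> S w /\
    exists n0 : nat, (1 <= n0)%N /\ forall n, (n0 <= n)%N ->
      X n w = X n0 w * \prod_(n0.+1 <= k < n.+1) (1 - \1_(B k) w * gamma k)}.
  have summable := ae_summable hpB hpBA hpA hgamma hx hU hUind hAm hBm hA hB
    hABind hABU hliminf.
  have jumps := ae_finitely_many_jumps hgamma hx hU hUind hAm hBm hA hB hABind hABU.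
  apply: filterS3 cvX summable jumps => w cvXw summable_w jumps_w Xw0.
  have bS : exists K, forall n,
      prefix_sum gamma x (hist (bandit_step gamma x U A B) n w) <= K.
    by apply: summable_w; rewrite -Xw0.
  have bJ := jumps_w bS.
  split; last exact: eventually_product bJ.
  exact: bounded_product_sums bS bJ.
have zero_gt0 : (0 < P S)%E -> (0 < P [set w | Xinf w = 0%R])%E.
  by apply: (prob_zero_gt0 hgamma hx hU hUind hAm hBm hABU mZ cvX).
have mean_zero_gt0 : bounded_sums (mean_prod gamma pB) ->
    (0 < P [set w | Xinf w = 0%R])%E.
  move=> bm; apply: zero_gt0; apply: (@lt_le_trans _ _ (P setT)).
    by rewrite probability_setT lte01.
  apply: ae_le_measure => //.
  have := ae_bounded_product_sums hpB hpBA hpA hgamma hx hU hUind hAm hBm hB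
    hABind hABU bm.
  by apply: filterS.
split.
  split; first split=> [PZ|//].
  - apply: lt_le_trans PZ _; apply: ae_le_measure => //.
    by apply: filterS ae_prod => w Sw /Sw[].
  - apply: filterS ae_prod => w Sw /Sw[_ [n0 [n01 Xn]]]; exists n0; split=> // n n0n.
    by rewrite !bandit_hist; exact: Xn.
  - by move=> /meanE.
move=> /nneseries_lt_pinftyP bg.
have {}bg : bounded_sums (fun k => gamma k ^+ 2).
  by apply: bg => n _; exact: sqr_ge0.
have ae_ratio := ae_product_equiv hpB hpBA hpA hgamma hx hU hUind hAm hBm hB
  hABind hABU bg.
split.
  rewrite meanE; split=> // PZ.
  have [w Zw [/(_ Zw)[Sw _] [L L0 cvL]]] :=
    ae_exists mZ PZ (filterI ae_prod ae_ratio).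
  exact: (mean_bounded_sums hpB hpBA hpA hgamma L0 cvL Sw).
have [Xi [Xi0 XiE]] := ratio_limit pB gamma x U hAm hBm.
exists Xi; split=> //.
apply: filterS2 ae_prod ae_ratio => w prod_w [L L0 cvL] /prod_w[_ [n0 [n01 Xn]]].
have {}Xn := product_ratio hgamma Xn.
set c := X n0 w / path_loss_prod gamma B n0 w.
have c0 : 0 < c by rewrite divr_gt0 //; exact: prod_gt0.
have cvXm : (fun n => X n w / mean_prod gamma pB n) @ \oo --> c * L.
  have : (fun n => c * (path_loss_prod gamma B n w / mean_prod gamma pB n)) @ \oo
      --> c * L.
    by apply: cvgM => //; exact: cvg_cst.
  apply: cvg_trans; apply: near_eq_cvg; exists n0 => // n n0n.
  by rewrite /X Xn // mulrA.
have XiL := XiE w (c * L) (mulr_gt0 c0 L0) cvXm.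
rewrite bE XiL; apply: cvg_ratio_equiv => //; first exact: mulr_gt0.
by move=> n; exact: mean_prod_gt0.
Qed.
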